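(* For each $n$, let $y\sim\mathrm N_n(\mu_0,\sigma_0^2I_n)$ with true parameters $\mu_0=\mu_{0,n}\in\mathbb R^n$ and $\sigma_0=\sigma_{0,n}>0$ (possibly depending on $n$), and let $\Pi=\Pi_n$ be a prior on $(\mu,\sigma)\in\mathbb R^n\times(0,\infty)$, with posterior $\Pi(\cdot\mid y)$ under the likelihood $y\mid(\mu,\sigma)\sim \mathrm N_n(\mu,\sigma^2I_n)$. Let $\epsilon_n>0$ satisfy $\epsilon_n/\sigma_0\to0$ and $n\epsilon_n^2/\sigma_0^2\to\infty$. Suppose there exist sets $\Theta_n\subset\mathbb R^n\times(0,\infty)$ and constants $C>0$, $D>0$, $E>0$ such that for all $n$ $$\Pi\{\lVert\mu-\mu_0\rVert_2^2\le n\epsilon_n^2,\ |\sigma^2-\sigma_0^2|\le\sigma_0\epsilon_n\}\ge e^{-Cn\epsilon_n^2/\sigma_0^2},\quad N(\epsilon_n,\Theta_n,d)\le e^{Dn\epsilon_n^2/\sigma_0^2},\quad \Pi\{(\mu,\sigma)\notin\Theta_n\}\le e^{-En\epsilon_n^2/\sigma_0^2}.$$ Then, provided $E$ is sufficiently large relative to $C$ (i.e., $E\ge E_0$ for a constant $E_0$ depending only on $C$), there exists a constant $M>0$ such that $$\mathbb E_{\mu_0,\sigma_0}\Pi\{(\mu,\sigma):d((\mu,\sigma),(\mu_0,\sigma_0))\ge M\epsilon_n\mid y\}\to0\quad (n\to\infty).$$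
   Context: $P_{\mu,\sigma}$ denotes $\mathrm N_n(\mu,\sigma^2I_n)$ and $\mathbb E_{\mu,\sigma}$ the expectation under it. The metric $d$ on $\mathbb R^n\times(0,\infty)$ is $d^2((\mu_1,\sigma_1),(\mu_2,\sigma_2))=n^{-1}\lVert\mu_1-\mu_2\rVert_2^2+|\sigma_1-\sigma_2|^2$. $N(\epsilon,\mathcal E,\rho)$ denotes the $\epsilon$-covering number of $\mathcal E$ with respect to $\rho$. *)

(* Defs.v *)
From HB Require Import structures.
From mathcomp Require Import all_boot all_order all_algebra.
From mathcomp Require Import all_classical all_reals all_analysis.
Set Implicit Arguments. Unset Strict Implicit. Unset Printing Implicit Defensive.
Import Order.TTheory GRing.Theory Num.Def Num.Theory.
Local Open Scope classical_set_scope.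
Local Open Scope ring_scope.

Section defs.
Context {R : realType}.

(* Parameter space R^n x R; (mu, sigma).  The sigma-component of a prior is
   required (in the theorem) to be supported on (0, oo). *)
Definition param (n : nat) := (n.-tuple R * R)%type.

Definition sqnorm2 n (m1 m2 : n.-tuple R) : R :=
  \sum_(i < n) (tnth m1 i - tnth m2 i) ^+ 2.

Definition dparam n (p q : param n) : R :=
  Num.sqrt (n%:R^-1 * sqnorm2 p.1 q.1 + `|p.2 - q.2| ^+ 2).

(* epsilon-covering number of A w.r.t. d (closed d-balls of radius eps,
   centres in R^n x (0,oo)), as an extended real (+oo if no finite cover) *)
Definition covering_number n (eps : R) (A : set (param n)) : \bar R :=
  ereal_inf [set (k%:R)%:E | k in [set k : nat |
     exists c : 'I_k -> param n, (forall i, 0 < (c i).2) /\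
       A `<=` \bigcup_(i in [set: 'I_k]) [set p | dparam p (c i) <= eps]]].

Definition lik n (p : param n) (y : seq R) : R :=
  \prod_(i < n) normal_pdf (tnth p.1 i) p.2 (nth 0 y i).

Definition posterior n (Pi : set (param n) -> \bar R) (A : set (param n))
    (y : seq R) : \bar R :=
  ((\int[Pi]_(p in A) (lik p y)%:E) / (\int[Pi]_p (lik p y)%:E))%E.

(* E_{m, s} f(y) for y ~ N(m, s^2 I), m given as the sequence of coordinates;
   iterated integral against the product of the univariate normal densities *)
Fixpoint gaussE (s : R) (m : seq R) (f : seq R -> \bar R) : \bar R :=
  match m with
  | [::] => f [::]
  | a :: m' => (\int[@lebesgue_measure R]_x
                  ((normal_pdf a s x)%:E * gaussE s m' (fun t => f (x :: t))))%E
  end.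

End defs.

(* Main.v *)
Require Import Defs.
From HB Require Import structures.
From mathcomp Require Import all_boot all_order all_algebra.
From mathcomp Require Import all_classical all_reals all_analysis.
From mathcomp Require Import measurable_realfun ring lra.
Import Order.TTheory GRing.Theory Num.Def Num.Theory.
Local Open Scope classical_set_scope.
Local Open Scope ring_scope.

(** Write p0 for the true density and p for that of a parameter.  If a set is
  covered by sets A_j, each with a statistic q_j and reals a_j, b_j of opposite
  signs, then exp(a_j q_j) or exp(b_j q_j) is at least 1, and hence for every
  Lam > 0 its posterior mass at y is at most
    sum_j exp(a_j q_j(y)) + Lam sum_j int_{A_j} exp(b_j q_j(y)) p/p0 dPi
      + Lam^-1 (int p/p0 dPi)^-1.
  By Cauchy-Schwarz the last term has mean at most Pi(B)^-1 times the supremum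
  over B of int p0^2/p, which is at most exp(3 n eps^2 / sigma0^2) when B is the
  prior neighbourhood; no high-probability event for the evidence is needed.
  For the q_j take +-|y - mu0|^2, which detects a standard deviation that is too
  large or too small, and <y - mu0, c - mu0>, which detects a remote mean close
  to a centre c of the covering; the exponential moments are then explicit
  Gaussian integrals.  Their errors beat Lam and the entropy once M is large, so
  that E is only constrained by the untested remainder outside Theta. *)

(** * Monotonicity of iterated Gaussian expectations *)

Section gaussE_theory.
Context {R : realType}.
Local Open Scope ereal_scope.

(* No measurability is required, so that it applies to [posterior] as a function
   of the observation. *)
Lemma ge0_le_integralT d (T : measurableType d) (mu : {measure set T -> \bar R})
    (f g : T -> \bar R) :
  (forall x, 0 <= f x) -> (forall x, f x <= g x) ->
  \int[mu]_x f x <= \int[mu]_x g x.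
Proof.
move=> f0 fg.
rewrite !ge0_integralTE//; last by move=> x; exact: le_trans (fg x).
by apply: ereal_sup_le => _ [h hf <-]; exists h => // x; exact: le_trans (fg x).
Qed.

Lemma gaussE_ge0 (s : R) (m : seq R) (f : seq R -> \bar R) :
  (forall y, 0 <= f y) -> 0 <= gaussE s m f.
Proof.
elim: m f => [|a m ih] f f0 //=.
apply: integral_ge0 => x _; rewrite mule_ge0// ?lee_fin ?normal_pdf_ge0//.
exact: ih.
Qed.

Lemma le_gaussE (s : R) (m : seq R) (f g : seq R -> \bar R) :
  (forall y, 0 <= f y) -> (forall y, f y <= g y) ->
  gaussE s m f <= gaussE s m g.
Proof.
elim: m f g => [|a m ih] f g f0 fg //=.
apply: ge0_le_integralT => x.
  by rewrite mule_ge0 ?lee_fin ?normal_pdf_ge0// gaussE_ge0.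
by rewrite lee_wpmul2l ?lee_fin ?normal_pdf_ge0 ?ih.
Qed.
End gaussE_theory.

(** * Tonelli for mixtures of products over the observations *)

Section gaussE_prod.
Context {R : realType}.
Local Open Scope ereal_scope.

Lemma emeasurable_prod d (T : measurableType d) (J : Type) (s : seq J)
    (f : J -> T -> \bar R) :
  (forall j, measurable_fun setT (f j)) ->
  measurable_fun setT (fun x => \prod_(j <- s) f j x).
Proof.
move=> mf; elim: s => [|j s ih].
  by under eq_fun do rewrite big_nil; exact: measurable_cst.
by under eq_fun do rewrite big_cons; exact: emeasurable_funM.
Qed.

(** Tonelli, one coordinate at a time: the factor of the first observation, frozen at [x], is
    absorbed into [k], which is why [k] is generalized in the induction. The sum over [j] stays
    inside [gaussE], so that additivity is only applied to integrands whose measurability is known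
    from their form. *)
Lemma gaussE_sum_prod d (T : measurableType d)
    (P : {sigma_finite_measure set T -> \bar R}) (J : Type) (r : seq J)
    (s : R) (m : seq R) (k : J -> T -> \bar R) (h : J -> nat -> T * R -> R) :
  (forall j, measurable_fun setT (k j)) -> (forall j t, 0 <= k j t) ->
  (forall j i, measurable_fun setT (h j i)) ->
  (forall j i z, (0 <= h j i z)%R) ->
  gaussE s m (fun y => \sum_(j <- r) \int[P]_p
      (k j p * \prod_(i < size m) (h j i (p, nth 0%R y i))%:E)) =
  \sum_(j <- r) \int[P]_p (k j p * \prod_(i < size m)
      \int[lebesgue_measure]_x (normal_pdf (nth 0%R m i) s x * h j i (p, x))%:E).
Proof.
elim: m k h => [|a m ih] k h mk k0 mh h0 /=.
  by apply: eq_bigr => j _; apply: eq_integral => p _; rewrite !big_ord0.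
have mpdf : measurable_fun setT (normal_pdf a s) by exact: measurable_normal_pdf.
pose G j i p := \int[lebesgue_measure]_x
  (normal_pdf (nth 0%R (a :: m) i) s x * h j i (p, x))%:E.
have hG0 j i p : 0 <= G j i p.
  by apply: integral_ge0 => x _; rewrite lee_fin mulr_ge0 ?normal_pdf_ge0.
have mpdfh j i b : measurable_fun setT
    (fun z : T * R => (normal_pdf b s z.2 * h j i z)%:E).
  apply/measurable_EFinP; apply: measurable_funM => //.
  by apply: measurableT_comp => //; exact: measurable_normal_pdf.
have mG j i : measurable_fun setT (G j i).
  apply: (measurable_fun_fubini_tonelli_F (m2 := lebesgue_measure)
    (fun z : T * R => (normal_pdf (nth 0%R (a :: m) i) s z.2 * h j i z)%:E)).
    exact: mpdfh.
  by move=> z; rewrite lee_fin mulr_ge0 ?normal_pdf_ge0.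
pose W j p := \prod_(i < size m) G j i.+1 p.
have W0 j p : 0 <= W j p by apply: prode_ge0.
have mW j : measurable_fun setT (W j) by apply: emeasurable_prod.
have mf j : measurable_fun setT (fun z : T * R =>
    (normal_pdf a s z.2 * h j 0%N z)%:E * (k j z.1 * W j z.1)).
  apply: emeasurable_funM => //; apply: emeasurable_funM.
    by apply: measurableT_comp => //.
  by apply: measurableT_comp => //.
have f0 j z : 0 <= (normal_pdf a s z.2 * h j 0%N z)%:E * (k j z.1 * W j z.1).
  by rewrite mule_ge0 ?lee_fin ?mulr_ge0 ?normal_pdf_ge0// mule_ge0.
(* First the induction hypothesis integrates out every observation but the first, leaving [W]; then
   the integrals over [x] and [p] are exchanged. *)
transitivity (\int[lebesgue_measure]_x \sum_(j <- r) \int[P]_p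
    ((normal_pdf a s x * h j 0%N (p, x))%:E * (k j p * W j p))).
  apply: eq_integral => x _.
  under [X in gaussE s m X]funext => t.
    under eq_bigr => j _ do under eq_integral => p _ do
      rewrite big_ord_recl /= muleA.
    over.
  rewrite (ih (fun j p => k j p * (h j 0%N (p, x))%:E) (fun j i => h j i.+1)) //.
  - rewrite ge0_sume_distrr; last first.
      move=> j _; apply: integral_ge0 => p _.
      by apply: mule_ge0; [apply: mule_ge0; rewrite ?lee_fin | exact: W0].
    apply: eq_bigr => j _; rewrite -ge0_integralZl ?lee_fin ?normal_pdf_ge0//.
    + by apply: eq_integral => p _; rewrite EFinM -!muleA; congr (_ * _);
        exact: muleCA.
    + apply: emeasurable_funM => //; last exact: mW.
      apply: emeasurable_funM => //; apply/measurable_EFinP.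
      exact: (measurableT_comp (mh j 0%N) (pair2_measurable x)).
    + by move=> p _; apply: mule_ge0; [apply: mule_ge0; rewrite ?lee_fin | exact: W0].
  - move=> j; apply: emeasurable_funM => //; apply/measurable_EFinP.
    exact: (measurableT_comp (mh j 0%N) (pair2_measurable x)).
  - by move=> j t; rewrite mule_ge0 ?lee_fin.
rewrite ge0_integral_sum//; last 2 first.
- move=> j; apply: (measurable_fun_fubini_tonelli_G (m1 := P)
    (fun z => (normal_pdf a s z.2 * h j 0%N z)%:E * (k j z.1 * W j z.1))) => //.
- by move=> j x _; apply: integral_ge0 => p _; exact: (f0 j (p, x)).
apply: eq_bigr => j _.
rewrite -(fubini_tonelli (m1 := P) (m2 := lebesgue_measure)
  (fun z => (normal_pdf a s z.2 * h j 0%N z)%:E * (k j z.1 * W j z.1)) (mf j) (f0 j))/=.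
apply: eq_integral => p _.
rewrite ge0_integralZr//; last 3 first.
- exact: (measurableT_comp (mpdfh j 0%N a) (pair1_measurable p)).
- by move=> x _; rewrite lee_fin mulr_ge0 ?normal_pdf_ge0.
- by rewrite mule_ge0.
by rewrite big_ord_recl /= muleCA.
Qed.

End gaussE_prod.

(** * Explicit one-dimensional Gaussian integrals *)

Section gauss_integrals.
Context {R : realType}.
Implicit Types m s c x u v w al be ga lam Q : R.

Lemma normal_pdf_gt0 m s x : s != 0 -> 0 < normal_pdf m s x.
Proof. by move=> s0; rewrite normal_pdfE// mulr_gt0 ?normal_peak_gt0 ?expR_gt0. Qed.

(** Completing the square: the integrand is a constant times the normal density with mean
    [m + be * s ^+ 2 / Q] and standard deviation [s / sqrtr Q]. *)
Lemma integral_normal_pdf_expR m s al be ga : s != 0 ->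
  let Q := 1 + 2 * al * s ^+ 2 in 0 < Q ->
  (\int[lebesgue_measure]_x
     (normal_pdf m s x * expR (- al * (x - m) ^+ 2 + be * (x - m) + ga))%:E =
   ((sqrtr Q)^-1 * expR (ga + be ^+ 2 * s ^+ 2 / (2 * Q)))%:E)%E.
Proof.
move=> s0 Q Q0.
have q0 : sqrtr Q != 0 by rewrite gt_eqF ?sqrtr_gt0.
have qs0 : s / sqrtr Q != 0 by rewrite mulf_neq0 ?invr_eq0.
pose c := (sqrtr Q)^-1 * expR (ga + be ^+ 2 * s ^+ 2 / (2 * Q)).
have c0 : 0 <= c by rewrite mulr_ge0 ?expR_ge0// invr_ge0.
transitivity (\int[lebesgue_measure]_x
    (c%:E * (normal_pdf (m + be * s ^+ 2 / Q) (s / sqrtr Q) x)%:E))%E; last first.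
  rewrite ge0_integralZl_EFin//.
  - by rewrite integral_normal_pdf mule1.
  - by move=> x _; rewrite lee_fin normal_pdf_ge0.
  - by apply/measurable_EFinP; exact: measurable_normal_pdf.
apply: eq_integral => x _; rewrite -EFinM; congr EFin.
rewrite !normal_pdfE// /normal_fun /c.
have -> : normal_peak (s / sqrtr Q) = sqrtr Q * normal_peak s.
  rewrite /normal_peak exprMn exprVn sqr_sqrtr ?(ltW Q0)//.
  have -> : s ^+ 2 / Q * pi *+ 2 = (s ^+ 2 * pi *+ 2) / Q.
    by ring.
  rewrite sqrtrM; last by rewrite mulrn_wge0// mulr_ge0 ?sqr_ge0 ?pi_ge0.
  by rewrite sqrtrV ?(ltW Q0)// invfM invrK mulrC.
rewrite -[LHS]mulrA -[in LHS]expRD -[sqrtr Q * _ * _]mulrA [RHS]mulrACA.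
rewrite mulVf// mul1r [RHS]mulrCA -[in RHS]expRD.
congr (_ * expR _).
rewrite expr_div_n sqr_sqrtr ?(ltW Q0)//.
(* Eliminating [al] in favour of [Q] leaves a rational identity whose only denominators are [Q] and
   [s]. *)
have -> : al = (Q - 1) / (2 * s ^+ 2) by rewrite /Q; field.
have Q00 : Q != 0 by rewrite gt_eqF.
by field; rewrite Q00 s0.
Qed.

(** The exponential moment of a noncentral chi-square variable, found by expanding the square about
    [m]. *)
Lemma integral_normal_pdf_expR_sqr m s c al ga : s != 0 ->
  let Q := 1 + 2 * al * s ^+ 2 in 0 < Q ->
  (\int[lebesgue_measure]_x
     (normal_pdf m s x * expR (- al * (x - c) ^+ 2 + ga))%:E =
   ((sqrtr Q)^-1 * expR (ga - al * (m - c) ^+ 2 / Q))%:E)%E.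
Proof.
move=> s0 Q Q0.
under eq_integral => x _.
  have -> : - al * (x - c) ^+ 2 + ga = - al * (x - m) ^+ 2
    + (- (2 * al * (m - c))) * (x - m) + (ga - al * (m - c) ^+ 2) by ring.
  over.
rewrite integral_normal_pdf_expR//; congr (_ * expR _)%:E.
rewrite -/Q; have Q00 : Q != 0 by rewrite gt_eqF.
have -> : al = (Q - 1) / (2 * s ^+ 2) by rewrite /Q; field.
by field; rewrite Q00 s0.
Qed.

Lemma integral_normal_pdf_expR_lin m s c be ga : s != 0 ->
  (\int[lebesgue_measure]_x
     (normal_pdf m s x * expR (be * (x - c) + ga))%:E =
   (expR (be * (m - c) + ga + be ^+ 2 * s ^+ 2 / 2))%:E)%E.
Proof.
move=> s0; have Q1 : 1 + 2 * 0 * s ^+ 2 = 1 :> R by ring.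
under eq_integral => x _.
  have -> : be * (x - c) + ga =
    - 0 * (x - m) ^+ 2 + be * (x - m) + (be * (m - c) + ga) by ring.
  over.
by rewrite integral_normal_pdf_expR// Q1// sqrtr1 invr1 mul1r mulr1.
Qed.

(** After squaring, [(1 + t)^-1 = 1 - t / (1 + t) <= expR (- (t / (1 + t)))], and [t / (1 + t)]
    exceeds [t - 2 * t ^+ 2] by [t ^+ 2 * (1 + 2 * t) / (1 + t)], which is nonnegative for
    [t >= - (1 / 2)]. *)
Lemma invr_sqrt_le_expR (t Q : R) : - (1 / 2) <= t -> 1 + t <= Q ->
  (sqrtr Q)^-1 <= expR (- (t / 2) + t ^+ 2).
Proof.
move=> t12 tQ; have t0 : 0 < 1 + t by lra.
have Q0 : 0 < Q by lra.
rewrite -(@ler_pXn2r _ 2)// ?nnegrE ?expR_ge0 ?invr_ge0//.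
rewrite exprVn sqr_sqrtr ?(ltW Q0)// -expRM_natr.
apply: (@le_trans _ _ (1 + t)^-1); first by rewrite lef_pV2.
apply: (@le_trans _ _ (expR (- (t / (1 + t))))).
  rewrite [leLHS](_ : _ = 1 - t / (1 + t)); last by field; rewrite gt_eqF.
  exact: expR_ge1Dx.
rewrite ler_expR -subr_ge0.
have -> : (- (t / 2) + t ^+ 2) * 2 - - (t / (1 + t)) =
   t ^+ 2 * (1 + 2 * t) / (1 + t) by field; rewrite gt_eqF.
by apply: divr_ge0; [apply: mulr_ge0; [exact: sqr_ge0|lra]|exact: ltW].
Qed.

(** The left-hand side is one plus a chi-square divergence. With [v] the ratio of the variances it
    equals [v / sqrtr (2 * v - 1)] times [expR ((m - c) ^+ 2 / s0 ^+ 2 / (2 * v - 1))]; the bound on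
    [r] keeps [2 * v - 1] above [1 / 2]. *)
Lemma normal_chi2_expR m s c s0 r : s0 != 0 -> s != 0 -> r <= 1 / 4 ->
  `|s ^+ 2 / s0 ^+ 2 - 1| <= r ->
  (\int[lebesgue_measure]_x (normal_pdf c s0 x *
      (normal_pdf c s0 x * (normal_pdf m s x)^-1))%:E <=
   (expR (r ^+ 2 + 2 * (m - c) ^+ 2 / s0 ^+ 2))%:E)%E.
Proof.
move=> s00 sn0 r14 vr.
have w0 : 0 < s0 ^+ 2 by rewrite exprn_even_gt0.
have s20 : 0 < s ^+ 2 by rewrite exprn_even_gt0.
set v := s ^+ 2 / s0 ^+ 2 in vr.
have v0 : 0 < v by rewrite divr_gt0.
have [v1 v2] : 1 - r <= v /\ v <= 1 + r by move: vr; rewrite ler_norml; lra.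
pose al := (2 * s0 ^+ 2)^-1 - (2 * s ^+ 2)^-1.
pose be := - ((m - c) / s ^+ 2); pose ga := (m - c) ^+ 2 / (2 * s ^+ 2).
have QE : 1 + 2 * al * s0 ^+ 2 = 2 - v^-1.
  by rewrite /al /v; field; rewrite s00 sn0.
have iv : v^-1 <= 4 / 3.
  rewrite (_ : 4 / 3 = (3 / 4)^-1); last by field.
  by rewrite lef_pV2 ?posrE//; lra.
have Q0 : 0 < 2 - v^-1 by lra.
have vn0 : v != 0 by rewrite gt_eqF.
have v21 : 2 * v - 1 != 0 by rewrite gt_eqF//; lra.
under eq_integral => x _.
  (* The density ratio is again the exponential of a quadratic polynomial, up to the quotient
     [sqrtr v] of the normalizing constants. *)
  have -> : normal_pdf c s0 x * (normal_pdf m s x)^-1 =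
      sqrtr v * expR (- al * (x - c) ^+ 2 + be * (x - c) + ga).
    have -> : sqrtr v = normal_peak s0 / normal_peak s.
      rewrite /normal_peak invrK -sqrtrV; last first.
        by rewrite mulrn_wge0// mulr_ge0 ?sqr_ge0 ?pi_ge0.
      rewrite -sqrtrM; last first.
        by rewrite invr_ge0 mulrn_wge0// mulr_ge0 ?sqr_ge0 ?pi_ge0.
      congr sqrtr; rewrite /v; move: (pi_gt0 R); move: pi => p p0.
      by field; rewrite s00 gt_eqF.
    rewrite !normal_pdfE// invfM mulrACA; congr (_ * _).
    rewrite /normal_fun -expRN -expRD; congr expR.
    by rewrite /al /be /ga; field; rewrite s00 sn0.
  rewrite mulrCA EFinM; over.
rewrite ge0_integralZl_EFin//; last 2 first.
- by move=> x _; rewrite lee_fin mulr_ge0 ?expR_ge0 ?normal_pdf_ge0.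
- apply/measurable_EFinP; apply: measurable_funM; first exact: measurable_normal_pdf.
  apply: measurableT_comp => //; do 2?apply: measurable_funD => //.
    apply: measurable_funM => //; apply: measurable_funX.
    by apply: measurable_funB.
  by apply: measurable_funM => //; apply: measurable_funB.
rewrite integral_normal_pdf_expR// QE// -EFinM lee_fin mulrA [leRHS]expRD.
apply: ler_pM; rewrite ?mulr_ge0 ?invr_ge0 ?expR_ge0//.
  rewrite -sqrtrV ?(ltW Q0)// -sqrtrM ?(ltW v0)//.
  rewrite -(@ler_pXn2r _ 2)// ?nnegrE ?expR_ge0// sqr_sqrtr; last first.
    by rewrite mulr_ge0 ?invr_ge0// ltW.
  rewrite -expRM_natr; apply: le_trans (expR_ge1Dx _).
  (* The term linear in [v - 1] cancels, so a relative error [r] in the variance costs only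
     [r ^+ 2]. *)
  have -> : v / (2 - v^-1) = 1 + (v - 1) ^+ 2 / (2 * v - 1).
    by field; rewrite vn0 v21.
  rewrite lerD2l ler_pdivrMr; last by lra.
  have h1 : (v - 1) ^+ 2 <= r ^+ 2.
    rewrite -subr_ge0 (_ : _ - _ = (r - (v - 1)) * (r + (v - 1))); last by ring.
    by apply: mulr_ge0; lra.
  apply: le_trans h1 _; rewrite -mulrA ler_peMr ?sqr_ge0//.
  by lra.
rewrite ler_expR /ga /be.
have -> : (m - c) ^+ 2 / (2 * s ^+ 2) +
      (- ((m - c) / s ^+ 2)) ^+ 2 * s0 ^+ 2 / (2 * (2 - v^-1))
   = ((m - c) ^+ 2 / s0 ^+ 2) * (2 * v - 1)^-1.
  have s2E : s ^+ 2 = v * s0 ^+ 2 by rewrite /v divfK// gt_eqF.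
  by rewrite s2E; field; rewrite s00 vn0 v21.
rewrite (_ : 2 * _ / _ = (m - c) ^+ 2 / s0 ^+ 2 * 2); last by ring.
apply: ler_wpM2l; first by rewrite divr_ge0 ?sqr_ge0.
by rewrite invf_ple ?posrE//; lra.
Qed.

End gauss_integrals.

(** * Measurability of the likelihood in the parameter *)

Section measurability.
Context {R : realType}.

Lemma measurable_funV_ge0 d (T : measurableType d) (f : T -> R) :
  (forall x, 0 <= f x) -> measurable_fun setT f ->
  measurable_fun setT (fun x => (f x)^-1).
Proof.
move=> f0 mf; have -> : (fun x => (f x)^-1) = (@powR R ^~ (-1)) \o f.
  by apply/funext => x /=; rewrite powR_inv1.
by apply: measurableT_comp => //; exact: measurable_powR.
Qed.

Lemma measurable_fun_sqrt d (T : measurableType d) (f : T -> R) :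
  measurable_fun setT f -> measurable_fun setT (fun x => sqrtr (f x)).
Proof.
move=> mf; apply: (measurableT_comp (f := @sqrtr R)) => //.
by apply: continuous_measurable_fun; exact: sqrt_continuous.
Qed.

(** Joint measurability in mean, standard deviation and observation is what Tonelli between prior
    and data requires. *)
Lemma measurable_fun_normal_pdf d (T : measurableType d) (m s x : T -> R) :
  measurable_fun setT m -> measurable_fun setT s -> measurable_fun setT x ->
  measurable_fun setT (fun t => normal_pdf (m t) (s t) (x t)).
Proof.
move=> mm ms mx.
(* At standard deviation 0, [normal_pdf] is by convention the indicator of the unit interval. *)
have -> : (fun t => normal_pdf (m t) (s t) (x t)) = (fun t => if s t == 0
    then \1_`[0, 1] (x t) else normal_peak (s t) * normal_fun (m t) (s t) (x t)).
  apply/funext => t; rewrite /normal_pdf; by case: ifP.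
apply: measurable_fun_ifT.
- by apply: measurable_fun_eqr.
- by apply: measurableT_comp => //; exact: measurable_indic.
- have ms2 : measurable_fun setT (fun t => s t ^+ 2) by exact: measurable_funX.
  apply: measurable_funM.
    apply: measurable_funV_ge0 => //; apply: measurable_fun_sqrt.
    under eq_fun do rewrite -mulr_natr.
    by apply: measurable_funM => //; apply: measurable_funM.
  apply: measurableT_comp => //; apply: measurable_funM.
    apply: measurableT_comp => //; apply: measurable_funX.
    exact: measurable_funB.
  apply: measurable_funV_ge0 => [t|]; first by rewrite mulrn_wge0 ?sqr_ge0.
  by under eq_fun do rewrite -mulr_natr; apply: measurable_funM.
Qed.

Lemma measurable_param_nth n i :
  measurable_fun setT (fun p : @param R n => nth 0 p.1 i).
Proof.
have [ni|ni] := ltnP i n; last first.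
  (* Past the last coordinate [nth] returns its default value 0. *)
  rewrite (_ : (fun _ => _) = cst 0); first exact: measurable_cst.
  by apply/funext => p; rewrite nth_default// size_tuple.
rewrite (_ : (fun _ => _) = (@tnth n R ^~ (Ordinal ni)) \o fst).
  by apply: measurableT_comp => //; exact: measurable_tnth.
by apply/funext => p /=; rewrite (tnth_nth 0).
Qed.

Lemma likE n (p : @param R n) y :
  lik p y = \prod_(i < n) normal_pdf (nth 0 p.1 i) p.2 (nth 0 y i).
Proof. by apply: eq_bigr => i _; rewrite (tnth_nth 0). Qed.

Lemma measurable_lik n y : measurable_fun setT (fun p : @param R n => lik p y).
Proof.
under eq_fun do rewrite likE.
apply: measurable_prod => i _; apply: measurable_fun_normal_pdf => //.
exact: measurable_param_nth.
Qed.

Lemma lik_ge0 n (p : @param R n) y : 0 <= lik p y.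
Proof. by apply: prodr_ge0 => i _; exact: normal_pdf_ge0. Qed.

Lemma lik_gt0 n (p : @param R n) y : p.2 != 0 -> 0 < lik p y.
Proof. by move=> p0; apply: prodr_gt0 => i _; exact: normal_pdf_gt0. Qed.

End measurability.

(** * Bound on the expected posterior mass by exponential moments *)

Section posterior_bound.
Context {R : realType}.

Lemma sume_two_sumT (J : finType) (F : (J + J) + unit -> \bar R) :
  (\sum_k F k = \sum_j F (inl (inl j)) + \sum_j F (inl (inr j)) + F (inr tt))%E.
Proof.
by rewrite !big_sumType /= (big_pred1 tt)//; case.
Qed.

Context {n : nat} (P : probability (@param R n) R).
Context (m : n.-tuple R) (s0 : R) (J : finType).
Context (A B : set (@param R n)) (AJ : J -> set (@param R n)).
Context (f g : J -> nat -> R -> R) (L beta : R).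
Hypothesis s00 : s0 != 0.
Hypothesis mA : measurable A.
Hypothesis mB : measurable B.
Hypothesis mAJ : forall j, measurable (AJ j).
Hypothesis mf : forall j i, measurable_fun setT (f j i).
Hypothesis mg : forall j i, measurable_fun setT (g j i).
Hypothesis P0 : P [set p | p.2 <= 0] = 0%E.
Hypothesis A_sub : forall p, A p -> 0 < p.2 -> exists j, AJ j p.
Hypothesis B_neq0 : forall p, B p -> p.2 != 0.
Hypothesis L0 : 0 < L.
Hypothesis beta0 : 0 < beta.
Hypothesis PB : P B = beta%:E.
Hypothesis fg : forall (j : J) (y : seq R),
  0 <= \sum_(i < n) f j i (nth 0 y i) \/ 0 <= \sum_(i < n) g j i (nth 0 y i).

(* The three families of terms of the pointwise bound on the posterior are written
   in the common form [\int[P]_p weight k p * \prod_i factor k i (p, y_i)], to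
   which [gaussE_sum_prod] applies. *)
Definition weight (k : (J + J) + unit) (p : @param R n) : \bar R :=
  match k with
  | inl (inl _) => 1%E
  | inl (inr j) => (L * \1_(AJ j) p)%:E
  | inr _ => (L^-1 * beta ^- 2 * \1_B p)%:E
  end.

Definition factor (k : (J + J) + unit) (i : nat) (z : @param R n * R) : R :=
  match k with
  | inl (inl j) => expR (f j i z.2)
  | inl (inr j) => expR (g j i z.2) * normal_pdf (nth 0 z.1.1 i) z.1.2 z.2
                    * (normal_pdf (nth 0 m i) s0 z.2)^-1
  | inr _ => normal_pdf (nth 0 m i) s0 z.2
            * (normal_pdf (nth 0 z.1.1 i) z.1.2 z.2)^-1
  end.

Lemma weight_ge0 k p : (0 <= weight k p)%E.
Proof.
by case: k => [[j|j]|[]] //=; rewrite lee_fin !mulr_ge0 ?invr_ge0 ?sqr_ge0// ltW.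
Qed.

Lemma measurable_weight k : measurable_fun setT (weight k).
Proof.
case: k => [[j|j]|[]] /=; first exact: measurable_cst.
- by apply/measurable_EFinP; apply: measurable_funM => //; exact: measurable_indic.
- by apply/measurable_EFinP; apply: measurable_funM => //; exact: measurable_indic.
Qed.

Lemma factor_ge0 k i z : 0 <= factor k i z.
Proof.
by case: k => [[j|j]|[]] /=;
  rewrite ?mulr_ge0 ?invr_ge0 ?expR_ge0 ?normal_pdf_ge0.
Qed.

Lemma measurable_factor k i : measurable_fun setT (factor k i).
Proof.
have mp : measurable_fun setT (fun z : @param R n * R =>
    normal_pdf (nth 0 z.1.1 i) z.1.2 z.2).
  apply: measurable_fun_normal_pdf => //.
    exact: (measurableT_comp (measurable_param_nth n i) measurable_fst).
  by apply: measurableT_comp.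
have m0 : measurable_fun setT (fun z : @param R n * R =>
    normal_pdf (nth 0 m i) s0 z.2).
  by apply: measurable_fun_normal_pdf.
case: k => [[j|j]|[]] /=.
- by apply: measurableT_comp => //; exact: measurableT_comp.
- apply: measurable_funM; first apply: measurable_funM => //.
    by apply: measurableT_comp => //; exact: measurableT_comp.
  by apply: measurable_funV_ge0 => // z; exact: normal_pdf_ge0.
- apply: measurable_funM => //.
  by apply: measurable_funV_ge0 => // z; exact: normal_pdf_ge0.
Qed.

Local Notation integrand k y p :=
  (weight k p * \prod_(i < n) (factor k i (p, nth 0%R y i))%:E)%E.
Local Notation term k y := (\int[P]_p integrand k y p)%E.

Lemma integrand_ge0 k y p : (0 <= integrand k y p)%E.
Proof.
rewrite mule_ge0 ?weight_ge0//.
by apply: prode_ge0 => i _; rewrite lee_fin factor_ge0.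
Qed.

Lemma measurable_integrand k y : measurable_fun setT (fun p => integrand k y p).
Proof.
apply: emeasurable_funM; first exact: measurable_weight.
apply: emeasurable_prod => i; apply/measurable_EFinP.
exact: (measurableT_comp (measurable_factor _ _) (pair2_measurable _)).
Qed.

Local Notation lik0 y := (lik (m, s0) y).

(** Every [p] in [A] with positive standard deviation lies in some [AJ j], where the likelihood may
    be multiplied by the exponential of the [g]-sum, which is at least 1; the remaining terms of the
    sum are nonnegative. *)
Lemma num_le y : (forall j, 0 <= \sum_(i < n) g j i (nth 0 y i)) ->
  (\int[P]_(p in A) (lik p y)%:E <=
    (lik0 y / L)%:E * \sum_j term (inl (inr j)) y)%E.
Proof.
move=> g0; have l0 : 0 < lik0 y by apply: lik_gt0.
have ml : measurable_fun setT (fun p : @param R n => (lik p y)%:E).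
  by apply/measurable_EFinP; exact: measurable_lik.
have mN : measurable [set p : @param R n | p.2 <= 0].
  rewrite -[X in measurable X]setTI.
  by apply: measurable_fun_ler.
(* The sets [AJ j] cover [A] only where the standard deviation is positive, and the prior does not
   charge the rest. *)
rewrite (ge0_negligible_integral (N := [set p : @param R n | p.2 <= 0]))//; last 2 first.
- exact: measurable_funTS.
- by move=> p _; rewrite lee_fin lik_ge0.
rewrite -ge0_integral_sum//; last 2 first.
- by move=> j; exact: measurable_integrand.
- by move=> j p _; exact: integrand_ge0.
rewrite -ge0_integralZl//; last 3 first.
- by apply: emeasurable_sum => j; exact: measurable_integrand.
- by move=> p _; apply: sume_ge0 => j _; exact: integrand_ge0.
- by rewrite lee_fin divr_ge0// ltW.
rewrite integral_mkcond; apply: ge0_le_integralT => p.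
  by rewrite patchE; case: ifP => // _; rewrite lee_fin lik_ge0.
have S0 : (0 <= \sum_j integrand (inl (inr j)) y p)%E.
  by apply: sume_ge0 => j _; exact: integrand_ge0.
rewrite patchE; case: ifPn => [|_]; last first.
  by rewrite mule_ge0// lee_fin divr_ge0// ltW.
rewrite inE => -[Ap /negP]; rewrite -ltNge => p0.
have [j jp] := A_sub p Ap p0.
apply: (@le_trans _ _ ((lik0 y / L)%:E * integrand (inl (inr j)) y p)%E); last first.
  apply: lee_wpmul2l; first by rewrite lee_fin divr_ge0// ltW.
  by rewrite (bigD1 j)// leeDl// sume_ge0// => k _; exact: integrand_ge0.
rewrite prodEFin /= -!EFinM lee_fin indicE mem_set// mulr1.
rewrite !big_split /= -expR_sum prodfV.
have -> : \prod_(i < n) normal_pdf (nth 0 m i) s0 (nth 0 y i) = lik0 y.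
  by rewrite likE.
rewrite -likE.
have -> : lik0 y / L * (L * (expR (\sum_(i < n) g j i (nth 0 y i)) * lik p y / lik0 y)) =
    expR (\sum_(i < n) g j i (nth 0 y i)) * lik p y.
  by field; rewrite !gt_eqF.
by rewrite ler_peMl ?lik_ge0// -expR0 ler_expR.
Qed.

(* Cauchy-Schwarz in linearized form: [2 c <= p0 / p + c^2 p / p0], with
   [c = beta p0 / int p dP] chosen at the end. *)
Lemma den_ge y (d : R) : 0 < d -> (\int[P]_p (lik p y)%:E = d%:E)%E ->
  ((lik0 y / (L * d))%:E <= term (inr tt) y)%E.
Proof.
move=> d0 dE; have l0 : 0 < lik0 y by apply: lik_gt0.
have ml : measurable_fun setT (fun p : @param R n => (lik p y)%:E).
  by apply/measurable_EFinP; exact: measurable_lik.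
pose c := beta * lik0 y / d.
have c0 : 0 < c by rewrite divr_gt0// mulr_gt0.
pose K := L^-1 * beta ^- 2.
have K0 : 0 < K by rewrite mulr_gt0 ?invr_gt0 ?exprn_gt0.
have K1 : 0 <= 2 * c * K by apply: ltW; do 2 apply: mulr_gt0 => //.
have K2 : 0 <= c ^+ 2 * K / lik0 y.
  by apply/ltW/divr_gt0 => //; apply: mulr_gt0 => //; exact: exprn_gt0.
have mW := measurable_integrand (inr tt) y; have W0 := integrand_ge0 (inr tt) y.
have H : ((2 * c * K)%:E * P B <= term (inr tt) y + (c ^+ 2 * K / lik0 y * d)%:E)%E.
  have -> : P B = (\int[P]_p (\1_B p)%:E)%E by rewrite integral_indic// setIT.
  rewrite -ge0_integralZl//; last first.
    by apply/measurable_EFinP; exact: measurable_indic.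
  rewrite [(_ * d)%:E]EFinM -dE -ge0_integralZl//; last first.
    by move=> p _; rewrite lee_fin lik_ge0.
  rewrite -ge0_integralD//; last 2 first.
  - by move=> p _; rewrite -EFinM lee_fin mulr_ge0 ?lik_ge0.
  - exact: measurable_funeM.
  apply: ge0_le_integralT => p.
    by rewrite -EFinM lee_fin mulr_ge0.
  rewrite indicE; case: (boolP (p \in B)) => [|_]; last first.
    rewrite mule0 adde_ge0//.
    by rewrite -EFinM lee_fin mulr_ge0 ?lik_ge0.
  rewrite inE => Bp; have lp : 0 < lik p y by apply: lik_gt0; exact: B_neq0.
  rewrite prodEFin /= indicE mem_set// !mulr1 -!EFinM -EFinD lee_fin.
  rewrite big_split /= prodfV -likE.
  have -> : \prod_(i < n) normal_pdf (nth 0 m i) s0 (nth 0 y i) = lik0 y.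
    by rewrite likE.
  rewrite -/K -subr_ge0 mulr1.
  have -> : K * (lik0 y / lik p y) + c ^+ 2 * K / lik0 y * lik p y - 2 * c * K =
     K * (lik0 y - c * lik p y) ^+ 2 / (lik0 y * lik p y).
    by field; rewrite !gt_eqF.
  by apply: divr_ge0; [apply: mulr_ge0 (ltW K0) (sqr_ge0 _)|apply/ltW/mulr_gt0].
move: H; case: (term (inr tt) y) => [r| |].
- rewrite PB -EFinM -EFinD !lee_fin => H.
  (* For this [c] the right-hand side is [K * beta ^+ 2 * lik0 y / d]; the factor [beta ^- 2] in [K]
     is there to cancel [beta ^+ 2]. *)
  have -> : lik0 y / (L * d) = 2 * c * K * beta - c ^+ 2 * K / lik0 y * d.
    by rewrite /c /K; field; rewrite !gt_eqF.
  by lra.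
- by move=> _; rewrite leey.
- by rewrite PB -EFinM addNye leeNy_eq.
Qed.

(** The posterior mass is at most 1. This suffices when some [f]-sum is nonnegative; otherwise all
    [g]-sums are, and the bounds on numerator and evidence combine. *)
Lemma posterior_le y : (posterior P A y <= \sum_k term k y)%E.
Proof.
have S0 k : (0 <= term k y)%E.
  by apply: integral_ge0 => p _; exact: integrand_ge0.
have l0 : 0 < lik0 y by apply: lik_gt0.
have ml : measurable_fun setT (fun p : @param R n => (lik p y)%:E).
  by apply/measurable_EFinP; exact: measurable_lik.
rewrite /posterior.
set num := (\int[P]_(p in A) _)%E; set den := (\int[P]_p _)%E.
have num0 : (0 <= num)%E by apply: integral_ge0 => p _; rewrite lee_fin lik_ge0.
have numden : (num <= den)%E.
  by apply: ge0_subset_integral => // p _; rewrite lee_fin lik_ge0.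
(* If the evidence is 0, so is the numerator; if it is infinite, its inverse is 0. In both cases the
   quotient vanishes. *)
have [d0|d0] := eqVneq den 0%E.
  have -> : num = 0%E by apply/eqP; rewrite eq_le num0 -d0 numden.
  by rewrite mul0e sume_ge0.
have [dy|dy] := eqVneq den +oo%E; first by rewrite dy invey mule0 sume_ge0.
have [d d1 dE] : exists2 d : R, 0 < d & den = d%:E.
  exists (fine den); last by rewrite fineK// ge0_fin_numE ?(le_trans num0)// ltey.
  by rewrite fine_gt0// lt0e d0 (le_trans num0 numden) ltey.
have [a a0 aE] : exists2 a : R, 0 <= a & num = a%:E.
  exists (fine num); first exact: fine_ge0.
  by rewrite fineK// ge0_fin_numE// (le_lt_trans numden)// dE ltry.
rewrite dE aE inver gt_eqF// -EFinM.
have ad : a <= d by move: numden; rewrite dE aE lee_fin.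
have [[j fj]|nf] := pselect (exists j, 0 <= \sum_(i < n) f j i (nth 0 y i)).
  apply: (@le_trans _ _ (term (inl (inl j)) y)); last first.
    by rewrite (bigD1 (inl (inl j)))// leeDl// sume_ge0.
  under eq_integral do rewrite /= mul1e prodEFin -expR_sum.
  rewrite integral_cst// [X in (_ * X)%E](_ : _ = 1%E); last exact: probability_setT.
  rewrite mule1 lee_fin.
  apply: (@le_trans _ _ 1); first by rewrite ler_pdivrMr// mul1r.
  by rewrite -expR0 ler_expR.
have g0 i : 0 <= \sum_(k < n) g i k (nth 0 y k).
  by have [H|//] := fg i y; exfalso; apply: nf; exists i.
have X := num_le y g0; have Y := den_ge y d d1 dE.
rewrite -/num aE in X.
apply: (@le_trans _ _ (\sum_j term (inl (inr j)) y + term (inr tt) y)%E); last first.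
  by rewrite sume_two_sumT -addeA leeDr// sume_ge0.
apply: (@le_trans _ _ ((a * L / lik0 y)%:E + (lik0 y / (L * d))%:E)%E); last first.
  apply: leeD => //.
  have -> : a * L / lik0 y = (lik0 y / L)^-1 * a by field; rewrite !gt_eqF.
  by rewrite EFinM lee_pdivrMl// divr_gt0.
rewrite -EFinD lee_fin.
(* With [u = a * L / lik0 y], the quotient [a / d] is at most 1 and is [u] times the second summand:
   the first summand suffices if [u] is at least 1, the second if [u] is below 1. *)
have [H|H] := leP (lik0 y) (a * L).
  apply: (@le_trans _ _ 1); first by rewrite ler_pdivrMr// mul1r.
  rewrite -[leLHS]addr0 lerD//; first by rewrite ler_pdivlMr// mul1r.
  by rewrite divr_ge0 ?mulr_ge0// ltW.
rewrite -[leLHS]add0r lerD//; first by rewrite divr_ge0 ?mulr_ge0// ltW.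
by rewrite ler_pdivrMr// invfM mulrA divfK ?gt_eqF// ler_pdivlMr// ltW.
Qed.

Lemma posterior_ge0 y : (0 <= posterior P A y)%E.
Proof.
by rewrite mule_ge0 ?inve_ge0//; apply: integral_ge0 => p _; rewrite lee_fin lik_ge0.
Qed.

Context (eta zeta : J -> R) (xi : R).
Hypothesis eta_ge : forall j, (\prod_(i < n) \int[lebesgue_measure]_x
  (normal_pdf (nth 0%R m i) s0 x * expR (f j i x))%:E <= (eta j)%:E)%E.
Hypothesis zeta_ge0 : forall j, 0 <= zeta j.
Hypothesis zeta_ge : forall j p, AJ j p -> (\prod_(i < n) \int[lebesgue_measure]_x
  (normal_pdf (nth 0%R p.1 i) p.2 x * expR (g j i x))%:E <= (zeta j)%:E)%E.
Hypothesis xi_ge : forall p, B p -> (\prod_(i < n) \int[lebesgue_measure]_x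
  (normal_pdf (nth 0%R m i) s0 x * (normal_pdf (nth 0%R m i) s0 x *
    (normal_pdf (nth 0%R p.1 i) p.2 x)^-1))%:E <= xi%:E)%E.

(** Integrating the pointwise bound turns each term into a product of one-dimensional integrals: an
    exponential moment under [(m, s0)], one under [p] after a change of measure, and the chi-square
    integral over [B]. *)
Lemma gaussE_posterior_le :
  (gaussE s0 (tval m) (posterior P A) <= \sum_j (eta j)%:E +
    \sum_j (L * zeta j)%:E * P (AJ j) + (L^-1 * beta^-1 * xi)%:E)%E.
Proof.
apply: (le_trans (le_gaussE _ _ _ _ posterior_ge0 posterior_le)).
have := @gaussE_sum_prod R _ _ P _ (index_enum ((J + J) + unit)%type) s0 (tval m)
  weight factor measurable_weight weight_ge0 measurable_factor factor_ge0.
rewrite size_tuple => ->; rewrite sume_two_sumT.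
have scale_le (c z : R) (D : set (@param R n)) (W : @param R n -> \bar R) :
    0 <= c -> 0 <= z -> measurable D -> (forall p, 0 <= W p)%E ->
    (forall p, D p -> W p <= z%:E)%E ->
    (\int[P]_p ((c * \1_D p)%:E * W p) <= (c * z)%:E * P D)%E.
  move=> c0 z0 mD W0 Wz.
  have -> : P D = (\int[P]_p (\1_D p)%:E)%E by rewrite integral_indic// setIT.
  rewrite -ge0_integralZl ?lee_fin ?mulr_ge0//; last first.
    by apply/measurable_EFinP; exact: measurable_indic.
  apply: ge0_le_integralT => p.
    by apply: mule_ge0 (W0 p); rewrite lee_fin mulr_ge0.
  rewrite indicE; case: (boolP (p \in D)) => [|_].
    rewrite inE => Dp; rewrite mulr1 mule1 EFinM.
    by apply: lee_wpmul2l; [rewrite lee_fin|exact: Wz].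
  by rewrite mulr0 mul0e mule0.
apply: leeD; first apply: leeD.
- apply: lee_sum => j _ /=.
  under eq_integral do rewrite mul1e.
  rewrite integral_cst// [X in (_ * X)%E](_ : _ = 1%E); last exact: probability_setT.
  by rewrite mule1; exact: eta_ge.
- apply: lee_sum => j _ /=; apply: scale_le => //; first exact: ltW.
    move=> p; apply: prode_ge0 => i _; apply: integral_ge0 => x _.
    by rewrite lee_fin !mulr_ge0 ?invr_ge0 ?expR_ge0 ?normal_pdf_ge0.
  move=> p /zeta_ge; apply: le_trans; rewrite le_eqVlt; apply/orP; left; apply/eqP.
  apply: eq_bigr => i _; apply: eq_integral => x _ /=; congr EFin.
  (* Change of measure: the density at [(m, s0)] cancels its inverse and the density at [p]
     remains. *)
  by rewrite mulrC divfK ?gt_eqF ?normal_pdf_gt0// mulrC.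
(* [B] has positive mass, hence a point, which shows that [xi] is nonnegative. *)
- have [p0 Bp0] : exists p, B p.
    apply/set0P/eqP => B0; move: PB; rewrite B0 measure0 => -[] b0.
    by move: beta0; rewrite -b0 ltxx.
  have x0 : 0 <= xi.
    rewrite -lee_fin; apply: le_trans (xi_ge p0 Bp0).
    apply: prode_ge0 => i _; apply: integral_ge0 => x _.
    by rewrite lee_fin !mulr_ge0 ?invr_ge0 ?normal_pdf_ge0.
  apply: le_trans (scale_le _ xi B _ _ x0 mB _ xi_ge) _.
  + by rewrite mulr_ge0 ?invr_ge0 ?sqr_ge0// ltW.
  + move=> p; apply: prode_ge0 => i _; apply: integral_ge0 => x _.
    by rewrite lee_fin !mulr_ge0 ?invr_ge0 ?normal_pdf_ge0.
  (* The mass of [B] cancels one of the two factors [beta^-1]. *)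
  rewrite PB -EFinM lee_fin le_eqVlt; apply/orP; left; apply/eqP.
  by field; rewrite !gt_eqF.
Qed.

End posterior_bound.

(** * Exponential tests for scale and location *)

Section tests.
Context {R : realType}.

Lemma prode_le_expR n (F : nat -> \bar R) (e : nat -> R) :
  (forall i, (i < n)%N -> 0 <= F i)%E ->
  (forall i, (i < n)%N -> F i <= (expR (e i))%:E)%E ->
  (\prod_(i < n) F i <= (expR (\sum_(i < n) e i))%:E)%E.
Proof.
elim: n => [|n ih] F0 Fe; first by rewrite !big_ord0 expR0.
rewrite !big_ord_recr /= expRD EFinM; apply: lee_pmul.
- by apply: prode_ge0 => i _; apply: F0; rewrite ltnS ltnW.
- exact: F0.
- by apply: ih => i ni; [apply: F0|apply: Fe]; rewrite ltnS ltnW.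
- exact: Fe.
Qed.

Lemma integral_normal_pdf_expR_ge0 (m s : R) (h : R -> R) :
  (0 <= \int[lebesgue_measure]_z (normal_pdf m s z * expR (h z))%:E)%E.
Proof.
by apply: integral_ge0 => z _; rewrite lee_fin mulr_ge0 ?expR_ge0 ?normal_pdf_ge0.
Qed.

(** Here [t] is any lower bound for [- (2 * lam * (s ^+ 2 / w))], so that a variance known only up
    to an inequality can be replaced by its bound in the normalizing factor. *)
Lemma integral_chi2_le (m s c w lam thr t : R) : s != 0 -> 0 < w ->
  - (1 / 2) <= t -> 1 + t <= 1 - 2 * lam * (s ^+ 2 / w) ->
  (\int[lebesgue_measure]_z
     (normal_pdf m s z * expR (lam * ((z - c) ^+ 2 / w - thr)))%:E <=
   (expR (- (t / 2) + t ^+ 2 - lam * thr +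
      lam * ((m - c) ^+ 2 / w) / (1 - 2 * lam * (s ^+ 2 / w))))%:E)%E.
Proof.
move=> s0 w0 t12 tQ; have wn0 : w != 0 by rewrite gt_eqF.
pose al := - (lam / w).
have QE : 1 + 2 * al * s ^+ 2 = 1 - 2 * lam * (s ^+ 2 / w).
  by rewrite /al; field.
have Q0 : 0 < 1 + 2 * al * s ^+ 2 by rewrite QE; lra.
under eq_integral => z _.
  have -> : lam * ((z - c) ^+ 2 / w - thr) = - al * (z - c) ^+ 2 + - (lam * thr).
    by rewrite /al; field.
  over.
rewrite integral_normal_pdf_expR_sqr// QE lee_fin.
rewrite (_ : - (lam * thr) - _ = - (lam * thr) +
    lam * ((m - c) ^+ 2 / w) / (1 - 2 * lam * (s ^+ 2 / w))); last first.
  by rewrite /al; congr (_ + _); rewrite -mulNr; congr (_ / _); field.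
rewrite -[in leRHS]addrA [leRHS]expRD ler_wpM2r ?expR_ge0//.
exact: invr_sqrt_le_expR.
Qed.

(* The sum of the [a * B i (y_i)] or that of the [b * B i (y_i)] is nonnegative
   since [a * b <= 0]: [eta] and [zeta] then play the role of the error bounds of
   a test of (m, s0) against S. *)
Definition separated n (m : n.-tuple R) (s0 : R) (S : set (@param R n))
    (eta zeta : R) : Prop :=
  exists (B : nat -> R -> R) (a b : R),
  [/\ (forall i, measurable_fun setT (B i)), a * b <= 0,
      (\prod_(i < n) \int[lebesgue_measure]_z
        (normal_pdf (nth 0%R m i) s0 z * expR (a * B i z))%:E <= eta%:E)%E &
      forall p, S p -> (\prod_(i < n) \int[lebesgue_measure]_z
        (normal_pdf (nth 0%R p.1 i) p.2 z * expR (b * B i z))%:E <= zeta%:E)%E].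

Context {n : nat} (m : n.-tuple R) (s0 : R).
Hypothesis s00 : 0 < s0.
Let w := s0 ^+ 2.
Let w0 : 0 < w. Proof. exact: exprn_gt0. Qed.
Let s0n0 : s0 != 0. Proof. by rewrite gt_eqF. Qed.
Let wv : s0 ^+ 2 / w = 1. Proof. by rewrite divff// gt_eqF. Qed.

(** A test that always accepts: it has no power over [S], whose small prior mass has to compensate
    for the bound 1. *)
Lemma separated_const (r : R) (S : set (@param R n)) : (forall p, S p -> 0 < p.2) ->
  separated n m s0 S (expR (- (n%:R * r))) 1.
Proof.
move=> Spos; exists (fun _ => cst 1), (- r), 0; split => //.
- by rewrite mulr0.
- have -> : - (n%:R * r) = \sum_(i < n) - r.
    by rewrite sumr_const card_ord -[RHS]mulr_natl mulrN.
  apply: (prode_le_expR n (fun i => \int[lebesgue_measure]_z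
    (normal_pdf (nth 0 m i) s0 z * expR (- r * 1))%:E)%E (fun=> - r)) => i _.
    exact: integral_normal_pdf_expR_ge0.
  rewrite mulr1; under eq_integral do rewrite mulrC EFinM.
  rewrite ge0_integralZl_EFin ?expR_ge0//.
  + by rewrite integral_normal_pdf mule1.
  + by move=> z _; rewrite lee_fin normal_pdf_ge0.
  + by apply/measurable_EFinP; exact: measurable_normal_pdf.
- move=> p _; rewrite big1// => i _.
  by under eq_integral do rewrite mul0r expR0 mulr1; exact: integral_normal_pdf.
Qed.

Lemma sqnorm2E (a b : n.-tuple R) :
  sqnorm2 a b = \sum_(i < n) (nth 0 a i - nth 0 b i) ^+ 2.
Proof. by apply: eq_bigr => i _; rewrite !(tnth_nth 0). Qed.

Lemma measurable_chi2 (c v thr : R) :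
  measurable_fun setT (fun z : R => (z - c) ^+ 2 / v - thr).
Proof.
apply: measurable_funB => //; apply: measurable_funM => //.
by apply: measurable_funX; apply: measurable_funB.
Qed.

(** The threshold [1 + x] lies between the null value 1 and [1 + 2 * x], a lower bound for the
    variance ratio. A shift of the mean only increases the residuals, hence helps; [lam] of order
    [x] makes the gain [lam * x] dominate the quadratic error. *)
Lemma separated_scale_large (x : R) (S : set (@param R n)) :
  0 <= x -> x <= 1 / 4 -> (forall p, S p -> s0 * (1 + x) <= p.2) ->
  separated n m s0 S (expR (- (n%:R * x ^+ 2 / 64))) (expR (- (n%:R * x ^+ 2 / 64))).
Proof.
move=> x0 x14 Sx; pose lam := x / 16.
exists (fun i z => (z - nth 0 m i) ^+ 2 / w - (1 + x)), lam, (- lam).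
have nE (e : R) : n%:R * e = \sum_(i < n) e by rewrite sumr_const card_ord mulr_natl.
have eE : - (n%:R * x ^+ 2 / 64) = \sum_(i < n) - (x ^+ 2 / 64) by rewrite -nE; ring.
split.
- by move=> i; exact: measurable_chi2.
- by rewrite mulrN oppr_le0 -expr2 sqr_ge0.
- rewrite eE.
  apply: (prode_le_expR n (fun i => \int[lebesgue_measure]_z
    (normal_pdf (nth 0 m i) s0 z *
     expR (lam * ((z - nth 0 m i) ^+ 2 / w - (1 + x))))%:E)%E (fun=> - (x ^+ 2 / 64))) => i _.
    exact: integral_normal_pdf_expR_ge0.
  apply: le_trans (integral_chi2_le _ _ _ _ _ _ (- (2 * lam)) s0n0 w0 _ _) _.
  + by rewrite /lam; lra.
  + by rewrite wv; lra.
  + by rewrite lee_fin ler_expR subrr expr0n !mul0r mulr0 mul0r /lam; nra.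
- move=> p Sp; rewrite eE.
  have p0 : 0 < p.2 by apply: lt_le_trans (Sx p Sp); rewrite mulr_gt0//; lra.
  have v1 : 1 + 2 * x <= p.2 ^+ 2 / w.
    rewrite ler_pdivlMr// /w; apply: (@le_trans _ _ ((s0 * (1 + x)) ^+ 2)).
      rewrite exprMn mulrC ler_wpM2l ?sqr_ge0//.
      by have := sqr_ge0 x; lra.
    by rewrite ler_pXn2r ?nnegrE ?Sx ?(ltW p0)// mulr_ge0 ?(ltW s00)//; lra.
  apply: (prode_le_expR n (fun i => \int[lebesgue_measure]_z
    (normal_pdf (nth 0 p.1 i) p.2 z *
     expR (- lam * ((z - nth 0 m i) ^+ 2 / w - (1 + x))))%:E)%E (fun=> - (x ^+ 2 / 64))) => i _.
    exact: integral_normal_pdf_expR_ge0.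
  have lam0 : 0 <= lam by rewrite /lam; lra.
  have t0 : 0 <= lam * (1 + 2 * x) by rewrite mulr_ge0//; lra.
  have t1 : lam * (1 + 2 * x) <= lam * (p.2 ^+ 2 / w) by rewrite ler_wpM2l.
  apply: le_trans (integral_chi2_le _ _ _ _ _ _ (2 * (lam * (1 + 2 * x))) _ w0 _ _) _.
  + by rewrite gt_eqF.
  + by lra.
  + by lra.
  + rewrite lee_fin ler_expR.
    have q0 : - lam * ((nth 0 p.1 i - nth 0 m i) ^+ 2 / w) /
        (1 - 2 * - lam * (p.2 ^+ 2 / w)) <= 0.
      rewrite !mulNr oppr_le0; apply: divr_ge0; last by lra.
      by apply: mulr_ge0 => //; apply: divr_ge0 (sqr_ge0 _) (ltW w0).
    apply: le_trans (lerD (lexx _) q0) _; rewrite addr0 /lam.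
    have h3 : x ^+ 2 * (1 + 2 * x) ^+ 2 <= x ^+ 2 * (9 / 4).
      by rewrite ler_wpM2l ?sqr_ge0//; nra.
    rewrite [leLHS](_ : _ = - (x ^+ 2 / 16) + x ^+ 2 * (1 + 2 * x) ^+ 2 / 64); last by field.
    by have := sqr_ge0 x; lra.
Qed.

(** Here a shift of the mean hides a small variance. The bound on the shift limits its cost to
    [x ^+ 3 / 8] per coordinate, which for [x <= 1 / 4] is below the gain of order [x ^+ 2]. *)
Lemma separated_scale_small (x : R) (S : set (@param R n)) :
  0 <= x -> x <= 1 / 4 -> (forall p, S p -> 0 < p.2 /\ p.2 <= s0 * (1 - x)) ->
  (forall p, S p -> sqnorm2 p.1 m <= n%:R * (x ^+ 2 * w)) ->
  separated n m s0 S (expR (- (n%:R * x ^+ 2 / 64))) (expR (- (n%:R * x ^+ 2 / 64))).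
Proof.
move=> x0 x14 Sx Sm; pose lam := x / 16.
have lam0 : 0 <= lam by rewrite /lam; lra.
exists (fun i z => (z - nth 0 m i) ^+ 2 / w - (1 - x / 2)), (- lam), lam.
have nE (e : R) : n%:R * e = \sum_(i < n) e by rewrite sumr_const card_ord mulr_natl.
have eE : - (n%:R * x ^+ 2 / 64) = \sum_(i < n) - (x ^+ 2 / 64) by rewrite -nE; ring.
split.
- by move=> i; exact: measurable_chi2.
- by rewrite mulNr oppr_le0 -expr2 sqr_ge0.
- rewrite eE.
  apply: (prode_le_expR n (fun i => \int[lebesgue_measure]_z
    (normal_pdf (nth 0 m i) s0 z *
     expR (- lam * ((z - nth 0 m i) ^+ 2 / w - (1 - x / 2))))%:E)%E
    (fun=> - (x ^+ 2 / 64))) => i _.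
    exact: integral_normal_pdf_expR_ge0.
  apply: le_trans (integral_chi2_le _ _ _ _ _ _ (2 * lam) s0n0 w0 _ _) _.
  + by lra.
  + by rewrite wv; lra.
  + by rewrite lee_fin ler_expR subrr expr0n !mul0r mulr0 mul0r /lam; nra.
- move=> p Sp; have [p0 px] := Sx p Sp.
  have v1 : p.2 ^+ 2 / w <= (1 - x) ^+ 2.
    by rewrite ler_pdivrMr// /w -exprMn ler_pXn2r ?nnegrE 1?mulrC//; nra.
  have v0 : 0 <= (1 - x) ^+ 2 by exact: sqr_ge0.
  have v2 : (1 - x) ^+ 2 <= 1 by nra.
  have t1 : lam * (p.2 ^+ 2 / w) <= lam * (1 - x) ^+ 2 by rewrite ler_wpM2l.
  have t2 : lam * (1 - x) ^+ 2 <= lam by rewrite ler_piMr.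
  have t3 : 0 <= lam * (1 - x) ^+ 2 by rewrite mulr_ge0.
  pose e i := - (- (2 * (lam * (1 - x) ^+ 2)) / 2) +
    (- (2 * (lam * (1 - x) ^+ 2))) ^+ 2 - lam * (1 - x / 2) +
    2 * lam / w * (nth 0 p.1 i - nth 0 m i) ^+ 2.
  apply: (@le_trans _ _ (expR (\sum_(i < n) e i))%:E).
    apply: (prode_le_expR n (fun i => \int[lebesgue_measure]_z
      (normal_pdf (nth 0 p.1 i) p.2 z *
       expR (lam * ((z - nth 0 m i) ^+ 2 / w - (1 - x / 2))))%:E)%E e) => i _.
      exact: integral_normal_pdf_expR_ge0.
    apply: le_trans (integral_chi2_le _ _ _ _ _ _
      (- (2 * (lam * (1 - x) ^+ 2))) _ w0 _ _) _.
    + by rewrite gt_eqF.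
    + by rewrite /lam in t2 *; lra.
    + by lra.
    + rewrite lee_fin ler_expR /e lerD2l.
      (* This denominator of the noncentrality term accounts for the factor 2 in [e]. *)
      have Q12 : 1 / 2 <= 1 - 2 * lam * (p.2 ^+ 2 / w) by rewrite /lam in t1 t2 *; lra.
      have d0 : 0 <= lam * ((nth 0 p.1 i - nth 0 m i) ^+ 2 / w).
        by rewrite mulr_ge0// divr_ge0 ?sqr_ge0// ltW.
      rewrite ler_pdivrMr; last by lra.
      have -> : 2 * lam / w * (nth 0 p.1 i - nth 0 m i) ^+ 2 =
        2 * (lam * ((nth 0 p.1 i - nth 0 m i) ^+ 2 / w)) by ring.
      by nra.
  rewrite lee_fin ler_expR /e big_split /= -nE -mulr_sumr -sqnorm2E.
  have d1 : 2 * lam / w * sqnorm2 p.1 m <= n%:R * (2 * lam * x ^+ 2).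
    have -> : n%:R * (2 * lam * x ^+ 2) = 2 * lam / w * (n%:R * (x ^+ 2 * w)).
      by field; rewrite gt_eqF.
    rewrite ler_wpM2l ?Sm// divr_ge0// ?(ltW w0)//; lra.
  apply: le_trans (lerD (lexx _) d1) _.
  rewrite -mulrDr eE -nE ler_wpM2l// /lam.
  have h1 : (x / 16 * (1 - x) ^+ 2) ^+ 2 <= (x / 16) ^+ 2.
    by rewrite ler_pXn2r ?nnegrE//; rewrite /lam in t3 t2; lra.
  have h2 : x * x ^+ 2 <= x ^+ 2 / 4.
    by have : 0 <= x ^+ 2 by [exact: sqr_ge0]; nra.
  rewrite [leLHS](_ : _ = x / 16 * (1 - x) ^+ 2 + 4 * (x / 16 * (1 - x) ^+ 2) ^+ 2
    - x / 16 * (1 - x / 2) + x / 8 * x ^+ 2); last by field.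
  have := sqr_ge0 x; rewrite (_ : x / 16 * (1 - x) ^+ 2 =
    x / 16 - x ^+ 2 / 8 + x * x ^+ 2 / 16) in h1 *; last by field.
  by rewrite expr_div_n in h1; lra.
Qed.

(** The statistic is the log-likelihood ratio of mean [c] against mean [m] at variance [w]. The
    exponent [1 / 2] gives the Hellinger affinity under [m]; the smaller [1 / 16] under [p] absorbs
    a variance of up to [4 * w]. *)
Lemma separated_location (x r : R) (c : n.-tuple R) (S : set (@param R n)) :
  64 * r ^+ 2 <= x ^+ 2 -> (forall p, S p -> 0 < p.2 /\ p.2 <= 2 * s0) ->
  (forall p, S p -> n%:R * (x ^+ 2 * w) <= sqnorm2 p.1 m) ->
  (forall p, S p -> sqnorm2 p.1 c <= n%:R * (r ^+ 2 * w)) ->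
  separated n m s0 S (expR (- (n%:R * x ^+ 2 / 1024))) (expR (- (n%:R * x ^+ 2 / 1024))).
Proof.
move=> rx Ss Sm Sc.
(* That [c] itself is far from [m] is deduced from a point of [S], so the empty set is treated
   apart. *)
have [/eqP S0|/set0P [q Sq]] := boolP (S == set0).
  have [] := separated_const (x ^+ 2 / 1024) set0 _ => // B [a [b [mB ab etaB _]]].
  by exists B, a, b; split => //; [rewrite -mulrA|rewrite S0].
pose u i := nth 0 c i - nth 0 m i.
have nE (e : R) : n%:R * e = \sum_(i < n) e by rewrite sumr_const card_ord mulr_natl.
have wn0 : w != 0 by rewrite gt_eqF.
(* From [|q - m|^2 <= 2 |c - m|^2 + 2 |q - c|^2], where the last distance is at most an eighth of
   the first. *)
have U_ge : n%:R * (x ^+ 2 / 4) <= \sum_(i < n) u i ^+ 2 / w.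
  rewrite -mulr_suml ler_pdivlMr//.
  have : sqnorm2 q.1 m <= 2 * (\sum_(i < n) u i ^+ 2) + 2 * sqnorm2 q.1 c.
    rewrite !sqnorm2E !mulr_sumr -big_split /=; apply: ler_sum => i _.
    rewrite -subr_ge0 (_ : _ - _ = (2 * nth 0 c i - nth 0 q.1 i - nth 0 m i) ^+ 2).
      exact: sqr_ge0.
    by rewrite /u; ring.
  have := Sm q Sq; have := Sc q Sq.
  have h : n%:R * (64 * r ^+ 2 * w) <= n%:R * (x ^+ 2 * w).
    by rewrite ler_wpM2l// ler_wpM2r// ltW.
  have h0 : 0 <= n%:R * (x ^+ 2 * w) by rewrite mulr_ge0// mulr_ge0 ?sqr_ge0// ltW.
  rewrite (_ : n%:R * (64 * r ^+ 2 * w) = 64 * (n%:R * (r ^+ 2 * w))) in h; last by ring.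
  rewrite (_ : n%:R * (x ^+ 2 / 4) * w = n%:R * (x ^+ 2 * w) / 4); last by ring.
  by lra.
exists (fun i z => ((z - nth 0 m i) * u i - u i ^+ 2 / 2) / w), (1 / 2), (- (1 / 16)).
split.
- move=> i; apply: measurable_funM => //; apply: measurable_funB => //.
  by apply: measurable_funM => //; apply: measurable_funB.
- by lra.
- apply: (@le_trans _ _ (expR (\sum_(i < n) - (u i ^+ 2 / w / 8)))%:E).
    apply: (prode_le_expR n (fun i => \int[lebesgue_measure]_z
      (normal_pdf (nth 0 m i) s0 z *
       expR (1 / 2 * (((z - nth 0 m i) * u i - u i ^+ 2 / 2) / w)))%:E)%E
      (fun i => - (u i ^+ 2 / w / 8))) => i _.
      exact: integral_normal_pdf_expR_ge0.
    under eq_integral => z _.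
      have -> : 1 / 2 * (((z - nth 0 m i) * u i - u i ^+ 2 / 2) / w) =
        u i / w / 2 * (z - nth 0 m i) + - (u i ^+ 2 / w / 4) by field.
      over.
    rewrite integral_normal_pdf_expR_lin// lee_fin ler_expR subrr mulr0 add0r.
    rewrite le_eqVlt; apply/orP; left; apply/eqP.
    by rewrite /w; field.
  rewrite lee_fin ler_expR sumrN lerN2 -mulr_suml.
  by have : 0 <= n%:R * x ^+ 2 by [rewrite mulr_ge0 ?sqr_ge0]; lra.
- move=> p Sp; have [p0 p2] := Ss p Sp.
  have v4 : p.2 ^+ 2 / w <= 4.
    rewrite ler_pdivrMr// /w (_ : 4 * s0 ^+ 2 = (2 * s0) ^+ 2); last by ring.
    by rewrite ler_pXn2r ?nnegrE ?mulr_ge0// ltW.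
  (* Summed, these are at most [- n x^2 / 512 + n r^2 / 16], and [64 * r ^+ 2 <= x ^+ 2] leaves the
     rate [1 / 1024]. *)
  pose e i := - (u i ^+ 2 / w / 128) + (nth 0 p.1 i - nth 0 c i) ^+ 2 / w / 16.
  apply: (@le_trans _ _ (expR (\sum_(i < n) e i))%:E).
    apply: (prode_le_expR n (fun i => \int[lebesgue_measure]_z
      (normal_pdf (nth 0 p.1 i) p.2 z *
       expR (- (1 / 16) * (((z - nth 0 m i) * u i - u i ^+ 2 / 2) / w)))%:E)%E e) => i _.
      exact: integral_normal_pdf_expR_ge0.
    under eq_integral => z _.
      have -> : - (1 / 16) * (((z - nth 0 m i) * u i - u i ^+ 2 / 2) / w) =
        - (u i / w / 16) * (z - nth 0 m i) + (u i ^+ 2 / w / 32) by field.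
      over.
    rewrite integral_normal_pdf_expR_lin ?gt_eqF// lee_fin ler_expR /e.
    have h1 : (- (u i / w / 16)) ^+ 2 * p.2 ^+ 2 / 2 <= u i ^+ 2 / w / 128.
      rewrite (_ : _ / 2 = u i ^+ 2 / w / 512 * (p.2 ^+ 2 / w)); last by field.
      rewrite (_ : u i ^+ 2 / w / 128 = u i ^+ 2 / w / 512 * 4); last by field.
      by rewrite ler_wpM2l// !divr_ge0 ?sqr_ge0// ltW.
    apply: le_trans (lerD (lexx _) h1) _; rewrite -subr_ge0.
    rewrite (_ : _ - _ = (nth 0 p.1 i - nth 0 m i - u i / 2) ^+ 2 / w / 16).
      by rewrite !divr_ge0 ?sqr_ge0// ltW.
    by rewrite /u; field.
  rewrite lee_fin ler_expR /e big_split /= sumrN -!mulr_suml -(sqnorm2E p.1 c).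
  rewrite -mulr_suml in U_ge.
  have d1 : sqnorm2 p.1 c / w <= n%:R * r ^+ 2.
    by rewrite ler_pdivrMr// -mulrA Sc.
  have h : n%:R * (64 * r ^+ 2) <= n%:R * x ^+ 2 by rewrite ler_wpM2l.
  by lra.
Qed.

Lemma separated_le S (eta zeta eta' zeta' : R) : eta <= eta' -> zeta <= zeta' ->
  separated n m s0 S eta zeta -> separated n m s0 S eta' zeta'.
Proof.
move=> he hz [B [a [b [mB ab e z]]]]; exists B, a, b; split => //.
  by apply: (le_trans e); rewrite lee_fin.
by move=> p /z; move=> /le_trans; apply; rewrite lee_fin.
Qed.

End tests.

(** * Contraction bound at a fixed sample size *)

Section contraction.
Context {R : realType}.

Lemma measurable_le_set d (T : measurableType d) (f g : T -> R) :
  measurable_fun setT f -> measurable_fun setT g ->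
  measurable [set t | f t <= g t].
Proof.
move=> mf mg; rewrite -[X in measurable X]setTI.
by apply: measurable_fun_ler.
Qed.

Lemma measurable_lt_set d (T : measurableType d) (f g : T -> R) :
  measurable_fun setT f -> measurable_fun setT g ->
  measurable [set t | f t < g t].
Proof.
move=> mf mg; rewrite -[X in measurable X]setTI.
by apply: measurable_fun_ltr.
Qed.

Lemma measurable_sqnorm2 n (a : n.-tuple R) :
  measurable_fun setT (fun p : @param R n => sqnorm2 p.1 a).
Proof.
under eq_fun do rewrite sqnorm2E.
apply: measurable_sum => i; apply: measurable_funX; apply: measurable_funB => //.
exact: measurable_param_nth.
Qed.

Lemma measurable_sd n : measurable_fun setT (fun p : @param R n => p.2).
Proof. exact: measurable_snd. Qed.

Lemma measurable_dparam n (q : @param R n) :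
  measurable_fun setT (fun p : @param R n => dparam p q).
Proof.
apply: measurable_fun_sqrt; apply: measurable_funD.
  by apply: measurable_funM => //; exact: measurable_sqnorm2.
apply: measurable_funX; apply: measurableT_comp => //.
by apply: measurable_funB => //; exact: measurable_sd.
Qed.

Lemma sqnorm2_le_dparam n (p q : @param R n) (e : R) : (0 < n)%N ->
  dparam p q <= e -> sqnorm2 p.1 q.1 <= n%:R * e ^+ 2.
Proof.
move=> n0 pq; have nr0 : 0 < n%:R :> R by rewrite ltr0n.
have S0 : 0 <= sqnorm2 p.1 q.1 by apply: sumr_ge0 => i _; exact: sqr_ge0.
have e0 : 0 <= e := le_trans (sqrtr_ge0 _) pq.
have d0 : 0 <= n%:R^-1 * sqnorm2 p.1 q.1 + `|p.2 - q.2| ^+ 2.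
  by rewrite addr_ge0 ?sqr_ge0// mulr_ge0// invr_ge0 ltW.
have : dparam p q ^+ 2 <= e ^+ 2 by rewrite ler_pXn2r ?nnegrE ?sqrtr_ge0.
rewrite sqr_sqrtr// => h; rewrite -ler_pdivrMl//.
by have := sqr_ge0 `|p.2 - q.2|; lra.
Qed.

Lemma dparam_lt n (p q : @param R n) (e : R) : (0 < n)%N -> 0 < e ->
  sqnorm2 p.1 q.1 <= n%:R * e ^+ 2 -> `|p.2 - q.2| <= e -> dparam p q < 2 * e.
Proof.
move=> n0 e0 h1 h2; have nr0 : 0 < n%:R :> R by rewrite ltr0n.
have h3 : `|p.2 - q.2| ^+ 2 <= e ^+ 2 by rewrite ler_pXn2r ?nnegrE// ltW.
have h4 : n%:R^-1 * sqnorm2 p.1 q.1 <= e ^+ 2 by rewrite ler_pdivrMl.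
have E0 : 0 < e ^+ 2 by exact: exprn_gt0.
rewrite -(@ger0_norm _ (2 * e)); last by rewrite mulr_ge0// ltW.
rewrite -sqrtr_sqr /dparam ltr_sqrt; last by rewrite exprn_gt0// mulr_gt0.
by rewrite exprMn; lra.
Qed.

Lemma covering_number_lt n (eps c : R) (S : set (@param R n)) :
  (covering_number eps S < c%:E)%E -> exists (k : nat) (a : 'I_k -> @param R n),
    k%:R < c /\ forall p, S p -> exists i, dparam p (a i) <= eps.
Proof.
move=> /ereal_inf_lt [_ [k [a [_ Sa]] <-]]; rewrite lte_fin => kc.
by exists k, a; split => // p /Sa [i _ ?]; exists i.
Qed.

(** With [r = eps / s0], the scale contributes [n r^2] to the exponent and the mean at most
    [2 n r^2]. *)
Lemma gaussE_chi2_le n (m : n.-tuple R) (p : @param R n) (s0 eps : R) :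
  0 < s0 -> eps / s0 <= 1 / 4 -> sqnorm2 p.1 m <= n%:R * eps ^+ 2 ->
  p.2 != 0 -> `|p.2 ^+ 2 - s0 ^+ 2| <= s0 * eps ->
  (\prod_(i < n) \int[lebesgue_measure]_x
     (normal_pdf (nth 0%R m i) s0 x * (normal_pdf (nth 0%R m i) s0 x *
       (normal_pdf (nth 0%R p.1 i) p.2 x)^-1))%:E <=
   (expR (3 * (n%:R * eps ^+ 2 / s0 ^+ 2)))%:E)%E.
Proof.
move=> s00 r14 Sp pn0 pv; have w0 : 0 < s0 ^+ 2 by exact: exprn_gt0.
pose e i := (eps / s0) ^+ 2 + 2 * (nth 0 p.1 i - nth 0 m i) ^+ 2 / s0 ^+ 2.
apply: (@le_trans _ _ (expR (\sum_(i < n) e i))%:E).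
  apply: (prode_le_expR n (fun i => \int[lebesgue_measure]_x
     (normal_pdf (nth 0 m i) s0 x * (normal_pdf (nth 0 m i) s0 x *
       (normal_pdf (nth 0 p.1 i) p.2 x)^-1))%:E)%E e) => i _.
    apply: integral_ge0 => x _.
    by rewrite lee_fin !mulr_ge0 ?invr_ge0 ?normal_pdf_ge0.
  apply: normal_chi2_expR => //; first by rewrite gt_eqF.
  rewrite (_ : _ - 1 = (p.2 ^+ 2 - s0 ^+ 2) / s0 ^+ 2); last first.
    by field; rewrite gt_eqF.
  rewrite normrM (@gtr0_norm _ (s0 ^- 2)) ?invr_gt0// ler_pdivrMr//.
  by rewrite (_ : eps / s0 * s0 ^+ 2 = s0 * eps)//; field; rewrite gt_eqF.
rewrite lee_fin ler_expR big_split /= sumr_const card_ord -[X in X + _]mulr_natl.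
rewrite -mulr_suml -mulr_sumr -sqnorm2E.
have d1 : sqnorm2 p.1 m / s0 ^+ 2 <= n%:R * eps ^+ 2 / s0 ^+ 2.
  by rewrite ler_wpM2r ?invr_ge0 ?(ltW w0).
by rewrite expr_div_n; lra.
Qed.

Context {n : nat} (P : probability (@param R n) R) (m : n.-tuple R).
Context (s0 eps K C D E : R) (Theta : set (@param R n)).
Hypothesis n0 : (0 < n)%N.
Hypothesis s00 : 0 < s0.
Hypothesis eps0 : 0 < eps.
Hypothesis D0 : 0 < D.
Hypothesis C0 : 0 < C.
Hypothesis P0 : P [set p | p.2 <= 0] = 0%E.
Hypothesis K8 : 8 <= K.
Hypothesis K_ge : C + D + 5 <= K ^+ 2 / 1024.
Hypothesis E_ge : C + 5 <= E.
Hypothesis r_le : K * (eps / s0) <= 1 / 4.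
Let L := n%:R * eps ^+ 2 / s0 ^+ 2.
Hypothesis prior_mass : ((expR (- (C * L)))%:E <=
  P [set p | (sqnorm2 p.1 m <= n%:R * eps ^+ 2)%R /\
             (`|p.2 ^+ 2 - s0 ^+ 2| <= s0 * eps)%R])%E.
Hypothesis mTheta : measurable Theta.
Hypothesis entropy : (covering_number eps Theta <= (expR (D * L))%:E)%E.
Hypothesis remaining_mass : (P (~` Theta) <= (expR (- (E * L)))%:E)%E.

Let nr0 : 0 < n%:R :> R. Proof. by rewrite ltr0n. Qed.
Let L0 : 0 < L.
Proof. by rewrite /L divr_gt0 ?exprn_gt0// mulr_gt0// exprn_gt0. Qed.

(** The tested separation in units of [s0]. *)
Let x := K * (eps / s0).
Let x0 : 0 < x.
Proof. by rewrite mulr_gt0 ?divr_gt0//; apply: lt_le_trans K8. Qed.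
Let r14 : eps / s0 <= 1 / 4.
Proof.
have r0 : 0 < eps / s0 by rewrite divr_gt0.
by apply: le_trans r_le; rewrite ler_peMl ?(ltW r0)//; move: K8; lra.
Qed.
Let epsE : eps ^+ 2 = (eps / s0) ^+ 2 * s0 ^+ 2.
Proof. by rewrite -exprMn divfK// gt_eqF. Qed.

(** One piece per centre for remote means, two for the scale, one outside [Theta]. Each piece
    carries the side conditions of its test: a remote mean comes with a bounded standard deviation,
    a small standard deviation with a mean near [m]. *)
Definition alternative k (c : 'I_k -> @param R n) (j : ('I_k + bool) + unit) :
    set (@param R n) :=
  match j with
  | inl (inl i) => [set p | 0 < p.2] `&` [set p | p.2 <= 2 * s0]
      `&` [set p | n%:R * (x ^+ 2 * s0 ^+ 2) <= sqnorm2 p.1 m]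
      `&` [set p | sqnorm2 p.1 (c i).1 <= n%:R * ((eps / s0) ^+ 2 * s0 ^+ 2)]
  | inl (inr true) => [set p | s0 * (1 + x) <= p.2]
  | inl (inr false) => [set p | 0 < p.2] `&` [set p | p.2 <= s0 * (1 - x)]
      `&` [set p | sqnorm2 p.1 m <= n%:R * (x ^+ 2 * s0 ^+ 2)]
  | inr tt => (~` Theta) `&` [set p | 0 < p.2]
  end.

Lemma measurable_alternative k (c : 'I_k -> @param R n) j :
  measurable (alternative k c j).
Proof.
have mS (a : n.-tuple R) : measurable_fun setT (fun p : @param R n => sqnorm2 p.1 a).
  exact: measurable_sqnorm2.
have m2 := measurable_sd n.
case: j => [[i|[]]|[]] /=; do ?[apply: measurableI].
all: try exact: measurableC.
all: try by apply: measurable_lt_set.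
all: by apply: measurable_le_set.
Qed.

Lemma alternative_cover k (c : 'I_k -> @param R n) p :
  (forall q, Theta q -> exists i, dparam q (c i) <= eps) ->
  2 * K * eps <= dparam p (m, s0) -> 0 < p.2 -> exists j, alternative k c j p.
Proof.
move=> cover pA p0; have [Tp|nT] := pselect (Theta p); last by exists (inr tt).
have [h1|h1] := leP (s0 * (1 + x)) p.2; first by exists (inl (inr true)).
have [h2|h2] := leP (n%:R * (x ^+ 2 * s0 ^+ 2)) (sqnorm2 p.1 m).
  have [i ci] := cover p Tp; exists (inl (inl i)) => /=; do 3?split => //.
    apply/ltW/(lt_le_trans h1); rewrite mulrC ler_pM2r//.
    by move: r_le; rewrite -/x; lra.
  by rewrite -epsE; apply: sqnorm2_le_dparam.
have [h3|h3] := leP p.2 (s0 * (1 - x)).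
  by exists (inl (inr false)) => /=; do 2?split => //; exact: ltW.
(* Otherwise both components of the distance are at most [x * s0 = K * eps], contradicting distance
   [2 * K * eps]. *)
exfalso; move: pA; apply/negP; rewrite -ltNge.
rewrite (_ : 2 * K * eps = 2 * (x * s0)); last by rewrite /x; field; rewrite gt_eqF.
apply: dparam_lt => //=; first by rewrite mulr_gt0.
  by rewrite exprMn ltW.
by rewrite ler_norml; apply/andP; split; nra.
Qed.

(** Since [n x^2 = K^2 L], the location test has exponent [K ^+ 2 / 1024 * L], and the scale tests,
    with 64 for 1024, do better. The bound [K >= 8] makes the covering radius small enough for the
    location test. *)
Lemma separated_alternative k (c : 'I_k -> @param R n) (j : ('I_k + bool) + unit) :
  separated n m s0 (alternative k c j)
    (if j is inl _ then expR (- (K ^+ 2 / 1024 * L)) else expR (- L))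
    (if j is inl _ then expR (- (K ^+ 2 / 1024 * L)) else 1).
Proof.
have xE : n%:R * x ^+ 2 = K ^+ 2 * L.
  by rewrite /x /L; field; rewrite gt_eqF.
have X0 : 0 <= n%:R * x ^+ 2 by rewrite mulr_ge0 ?sqr_ge0// ltW.
have x1 : 0 <= x by exact: ltW.
case: j => [[i|[]]|[]] /=.
- rewrite (_ : K ^+ 2 / 1024 * L = n%:R * x ^+ 2 / 1024); last by rewrite xE; ring.
  apply: (separated_location m s0 s00 x (eps / s0) (c i).1).
  + rewrite /x [leRHS]exprMn ler_wpM2r ?sqr_ge0//.
    have K0 : 0 <= K by apply: le_trans K8.
    by rewrite (_ : 64 = 8 ^+ 2 :> R); [rewrite ler_pXn2r ?nnegrE|ring].
  + by move=> p [[[]]].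
  + by move=> p [[]].
  + by move=> p [].
- apply: separated_le (separated_scale_large m s0 s00 x _ x1 r_le _);
    by [rewrite ler_expR; lra|].
- apply: separated_le (separated_scale_small m s0 s00 x _ x1 r_le _ _).
  1,2: by rewrite ler_expR; lra.
  + by move=> p [[]].
  + by move=> p [].
- rewrite (_ : L = n%:R * (eps / s0) ^+ 2); last by rewrite expr_div_n /L; ring.
  by apply: separated_const => p [].
Qed.

(** The factor 11 is [4 + 1 + 4 + 1 + 1]: errors under the truth from the tests and from the trivial
    test, errors under the alternatives, prior mass outside [Theta], and evidence. *)
Lemma gaussE_posterior_far_le :
  (gaussE s0 (tval m) (posterior P [set p | (2 * K * eps <= dparam p (m, s0))%R])
    <= (11 * expR (- L))%:E)%E.
Proof.
(* A cover is extracted from the infimum through a strict inequality, hence the [+ 1]. *)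
have [k [c [kD cover]]] : exists (k : nat) (a : 'I_k -> @param R n),
    k%:R < expR (D * L) + 1 /\ forall p, Theta p -> exists i, dparam p (a i) <= eps.
  by apply: covering_number_lt; apply: (le_lt_trans entropy); rewrite lte_fin ltrDl.
pose B := [set p : @param R n | sqnorm2 p.1 m <= n%:R * eps ^+ 2 /\
  `|p.2 ^+ 2 - s0 ^+ 2| <= s0 * eps].
have prior_massB : ((expR (- (C * L)))%:E <= P B)%E by exact: prior_mass.
have mB : measurable B.
  apply: (measurableI [set p : @param R n | sqnorm2 p.1 m <= n%:R * eps ^+ 2]
    [set p : @param R n | `|p.2 ^+ 2 - s0 ^+ 2| <= s0 * eps]).
    by apply: measurable_le_set => //; exact: measurable_sqnorm2.
  apply: measurable_le_set => //; apply: measurableT_comp => //.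
  by apply: measurable_funB => //; apply: measurable_funX; exact: measurable_sd.
have PB : P B = (fine (P B))%:E by rewrite fineK// fin_num_measure.
have beta_ge : expR (- (C * L)) <= fine (P B) by rewrite -lee_fin -PB; exact: prior_massB.
have beta0 : 0 < fine (P B) by apply: lt_le_trans beta_ge; exact: expR_gt0.
(* A zero standard deviation would give [s0 ^+ 2 <= s0 * eps], against [eps / s0 <= 1 / 4]. *)
have B_neq0 p : B p -> p.2 != 0.
  case=> _; apply: contraTneq => ->; rewrite expr0n /= sub0r normrN -ltNge.
  rewrite ger0_norm ?sqr_ge0// expr2 ltr_pM2l//.
  by rewrite -[ltRHS]mul1r -ltr_pdivrMr//; apply: le_lt_trans r14 _; lra.
have /choice[F HF] j := separated_alternative k c j.
have /choice[a {}HF] j := HF j.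
have /choice[b {}HF] j := HF j.
(* The evidence term is at most [Lam^-1 * expR (C * L) * expR (3 * L)], which this choice makes
   [expR (- L)]. *)
pose Lam := expR ((C + 4) * L).
have mA : measurable [set p : @param R n | 2 * K * eps <= dparam p (m, s0)].
  by apply: measurable_le_set => //; exact: measurable_dparam.
apply: le_trans.
  apply: (@gaussE_posterior_le R n P m s0 _ [set p | 2 * K * eps <= dparam p (m, s0)]
    B (alternative k c) (fun j i z => a j * F j i z) (fun j i z => b j * F j i z)
    Lam (fine (P B)) _ mA mB _ _ _ P0 _ B_neq0 _ beta0 PB _
    (fun j => if j is inl _ then expR (- (K ^+ 2 / 1024 * L)) else expR (- L))
    (fun j => if j is inl _ then expR (- (K ^+ 2 / 1024 * L)) else 1)
    (expR (3 * L))).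
  - by rewrite gt_eqF.
  - exact: measurable_alternative.
  - by move=> j i; have [mF _ _ _] := HF j; exact: measurable_funM.
  - by move=> j i; have [mF _ _ _] := HF j; exact: measurable_funM.
  - by move=> p; exact: alternative_cover.
  - exact: expR_gt0.
  (* If [a j * S] and [b j * S] were both negative, their product [a j * b j * S ^+ 2] would be
     positive. *)
  - move=> j y; rewrite -!mulr_sumr; have [_ ab _ _] := HF j.
    set S := \sum_(i < n) _; have [aS|aS] := leP 0 (a j * S); first by left.
    right; rewrite leNgt; apply/negP => bS.
    have : 0 < (a j * S) * (b j * S) by rewrite nmulr_rgt0.
    by rewrite mulrACA -expr2 ltNge mulr_le0_ge0 ?sqr_ge0.
  - by move=> j; have [_ _ + _] := HF j.
  - by case=> [?|[]]; [exact: expR_ge0|exact: ler01].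
  - by move=> j p Sp; have [_ _ _] := HF j; apply.
  - by move=> p [p1 p2]; apply: gaussE_chi2_le => //; apply: B_neq0.
have sumJ (u v : R) : \sum_(j : ('I_k + bool) + unit) (if j is inl _ then u else v) =
    (k%:R + 2) * u + v.
  rewrite big_sumType /= sumr_const card_sum card_ord card_bool (big_pred1 tt); last by case.
  by rewrite -[u *+ _]mulr_natl natrD.
pose e1 := expR (- (K ^+ 2 / 1024 * L)).
have S1 : (\sum_(j : ('I_k + bool) + unit)
    (if j is inl _ then e1 else expR (- L))%:E = ((k%:R + 2) * e1 + expR (- L))%:E)%E.
  by rewrite sumEFin sumJ.
have Lam0 : 0 < Lam by exact: expR_gt0.
have S2 : (\sum_(j : ('I_k + bool) + unit)
    (Lam * (if j is inl _ then e1 else 1))%:E * P (alternative k c j) <=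
    ((k%:R + 2) * (Lam * e1) + Lam * expR (- (E * L)))%:E)%E.
  (* For tested pieces the prior mass is bounded by 1; only for the remainder is it kept. *)
  rewrite -sumJ -sumEFin; apply: lee_sum => -[j|[]] _.
    rewrite -[leRHS]mule1; apply: lee_wpmul2l.
      by rewrite lee_fin mulr_ge0 ?expR_ge0// ltW.
    by apply: probability_le1; exact: measurable_alternative.
  rewrite mulr1 EFinM; apply: lee_wpmul2l; first by rewrite lee_fin ltW.
  apply: le_trans remaining_mass; apply: le_measure; rewrite ?inE.
  - exact: (measurable_alternative k c (inr tt)).
  - exact: measurableC.
  - by move=> p [].
have bexp : Lam^-1 * (fine (P B))^-1 * expR (3 * L) <= expR (- L).
  apply: (@le_trans _ _ (Lam^-1 * expR (C * L) * expR (3 * L))).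
    rewrite ler_wpM2r ?expR_ge0// ler_wpM2l ?invr_ge0 ?(ltW Lam0)//.
    by rewrite -[expR (C * L)]invrK -expRN lef_pV2 ?posrE ?expR_gt0.
  by rewrite /Lam -expRN -!expRD ler_expR; lra.
rewrite -/e1 S1; apply: le_trans (leeD (leeD (lexx _) S2) (lexx _)) _.
rewrite -!EFinD lee_fin.
have kD2 : k%:R + 2 <= 4 * expR (D * L).
  have : 1 <= expR (D * L) by rewrite -expR0 ler_expR mulr_ge0// ltW.
  by lra.
have expL t : 1 <= t -> expR (- (t * L)) <= expR (- L).
  by move=> t1; rewrite ler_expR lerN2 ler_peMl// ltW.
have T1 : (k%:R + 2) * e1 <= 4 * expR (- L).
  apply: (@le_trans _ _ (4 * expR (D * L) * e1)); first by rewrite ler_wpM2r ?expR_ge0.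
  rewrite -mulrA ler_wpM2l// /e1 -expRD.
  rewrite (_ : _ + _ = - ((K ^+ 2 / 1024 - D) * L)); last by ring.
  by apply: expL; move: K_ge C0; lra.
have T2 : (k%:R + 2) * (Lam * e1) <= 4 * expR (- L).
  apply: (@le_trans _ _ (4 * expR (D * L) * (Lam * e1))).
    by rewrite ler_wpM2r// mulr_ge0 ?expR_ge0.
  rewrite -mulrA ler_wpM2l// /e1 /Lam -!expRD.
  rewrite (_ : _ + _ = - ((K ^+ 2 / 1024 - D - C - 4) * L)); last by ring.
  by apply: expL; move: K_ge; lra.
have T3 : Lam * expR (- (E * L)) <= expR (- L).
  rewrite /Lam -expRD (_ : _ + _ = - ((E - C - 4) * L)); last by ring.
  by apply: expL; move: E_ge; lra.
by lra.
Qed.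

End contraction.

(** * Passage to the limit and choice of the constants *)

Section cvg.
Import numFieldNormedType.Exports.
Lemma cvg_expRN_EFin (R : realType) (u : nat -> R) (c : R) :
  u @ \oo --> +oo -> (fun n => (c * expR (- u n))%:E) @ \oo --> 0%E.
Proof.
move=> uy; apply: cvg_EFin; first exact: nearW.
rewrite -[X in _ --> X](mulr0 c).
apply: cvgMl_tmp.
exact: (cvg_comp u (fun t => expR (- t)) uy (@cvgr_expR R)).
Qed.
End cvg.

Theorem theorem3 (R : realType) (C : R) : 0 < C ->
  exists E0 : R, forall (D E : R) (mu0 : forall n : nat, n.-tuple R)
    (sigma0 eps : nat -> R)
    (Pi : forall n : nat, probability (param n) R)
    (Theta : forall n : nat, set (param n)),
  0 < D -> 0 < E -> E0 <= E ->
  (forall n, 0 < sigma0 n) ->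
  (forall n, 0 < eps n) ->
  (fun n => eps n / sigma0 n) @ \oo --> 0 ->
  (fun n => n%:R * eps n ^+ 2 / sigma0 n ^+ 2) @ \oo --> +oo ->
  (forall n, Pi n [set p | p.2 <= 0] = 0%E) ->
  (forall n, (0 < n)%N ->
     ((expR (- (C * n%:R * eps n ^+ 2 / sigma0 n ^+ 2)))%:E <=
       Pi n [set p | (sqnorm2 p.1 (mu0 n) <= n%:R * eps n ^+ 2)%R /\
                     (`|p.2 ^+ 2 - sigma0 n ^+ 2| <= sigma0 n * eps n)%R])%E) ->
  (forall n, (0 < n)%N ->
     measurable (Theta n) /\ Theta n `<=` [set p | 0 < p.2] /\
     (covering_number (eps n) (Theta n) <=
        (expR (D * n%:R * eps n ^+ 2 / sigma0 n ^+ 2))%:E)%E /\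
     (Pi n (~` Theta n) <=
        (expR (- (E * n%:R * eps n ^+ 2 / sigma0 n ^+ 2)))%:E)%E) ->
  exists M : R, 0 < M /\
    (fun n => gaussE (sigma0 n) (tval (mu0 n))
       (posterior (Pi n)
          [set p | M * eps n <= dparam p (mu0 n, sigma0 n)])) @ \oo --> 0%E.
Proof.
(* [E] has to beat the exponent [C + 4] of [Lam] by 1. The choice of [K] makes [K ^+ 2 / 1024] equal
   to [(C + D + 5) * K], which beats [Lam] and the entropy together. *)
move=> C0; exists (C + 5) => D E mu0 s0 eps Pi Theta D0 E0 E_ge s00 eps0 r0 Linfty.
move=> Pneg prior hTheta; pose K := 1024 * (C + D + 5).
have K8 : 8 <= K by rewrite /K; lra.
have K_ge : C + D + 5 <= K ^+ 2 / 1024.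
  rewrite (_ : K ^+ 2 / 1024 = (C + D + 5) * K); last by rewrite /K; field.
  by rewrite ler_peMr//; lra.
exists (2 * K); split; first by lra.
pose L n := n%:R * eps n ^+ 2 / s0 n ^+ 2.
have upper := @cvg_expRN_EFin R L 11 Linfty.
apply: squeeze_cvge (cvg_cst 0%E) upper.
(* The tests need a separation of at most [1 / 4], which holds eventually as [eps n / s0 n] tends to
   0. *)
have rK : \forall n \near \oo, K * (eps n / s0 n) <= 1 / 4.
  have d0 : 0 < 1 / 4 / K by rewrite divr_gt0//; lra.
  near=> n; rewrite mulrC -ler_pdivlMr; last by lra.
  by near: n; apply: (cvgr_le 0 r0).
near=> n; apply/andP; split.
  by apply: gaussE_ge0 => y; exact: posterior_ge0.
have n0 : (0 < n)%N by near: n; exists 1%N.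
have [mT [Tpos [ent rem]]] := hTheta n n0.
have LE c : c * n%:R * eps n ^+ 2 / s0 n ^+ 2 = c * L n by rewrite /L !mulrA.
have pr := prior n n0; rewrite !LE in pr ent rem.
apply: (gaussE_posterior_far_le _ _ _ _ _ C D E (Theta n)) => //.
by near: n.
Unshelve. all: by end_near. Qed.
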